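(* Consider a sequence (indexed by $n\to\infty$) of attributed Erdős–Rényi pairs $\mathcal{G}(n,\bm p;m,\bm q)$, where $m$, $\bm p$, $\bm q$ may depend on $n$, written in the subsampling form $$p_{11}=p\,s_{\mathrm u,1}s_{\mathrm u,2},\quad p_{10}=p\,s_{\mathrm u,1}(1-s_{\mathrm u,2}),\quad p_{01}=p(1-s_{\mathrm u,1})s_{\mathrm u,2},\quad p_{00}=p(1-s_{\mathrm u,1})(1-s_{\mathrm u,2})+1-p,$$ $$q_{11}=q\,s_{\mathrm a,1}s_{\mathrm a,2},\quad q_{10}=q\,s_{\mathrm a,1}(1-s_{\mathrm a,2}),\quad q_{01}=q(1-s_{\mathrm a,1})s_{\mathrm a,2},\quad q_{00}=q(1-s_{\mathrm a,1})(1-s_{\mathrm a,2})+1-q,$$ with $p,q,s_{\mathrm u,1},s_{\mathrm u,2},s_{\mathrm a,1},s_{\mathrm a,2}\in[0,1]$ (depending on $n$). Assume $$1-p=\Theta(1),\quad 1-q=\Theta(1),\quad s_{\mathrm u,1}s_{\mathrm u,2}=\Omega\!\left(\frac{(\log n)^4}{n}\right),\quad s_{\mathrm a,1}s_{\mathrm a,2}=\Omega\!\left(\frac{(\log n)^3}{m}\right).$$ Then: (i) if $np_{11}+mq_{11}-\log n\to\infty$, the MAP estimator achieves exact alignment with high probability, i.e. $\lim_{n\to\infty}\mathsf P(\hat\pi_{\mathrm{MAP}}(G_1,G_2')\ne\Pi^* )=0$; (ii) if $np_{11}+mq_{11}-\log n\to-\infty$, the error probability of any estimator is bounded away from zero: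 for any sequence of estimators $\hat\pi$, $\liminf_{n\to\infty}\mathsf P(\hat\pi(G_1,G_2')\neq\Pi^* )>0$.
   Context: Attributed Erdős–Rényi pair $\mathcal{G}(n,\bm p;m,\bm q)$: two random graphs $G_1,G_2$ on a common vertex set consisting of $n$ user vertices $\mathcal V_{\mathrm u}=[n]$ and $m$ attribute vertices $\mathcal V_{\mathrm a}$ (disjoint from $\mathcal V_{\mathrm u}$). Let $\mathcal E_{\mathrm u}$ be the set of (unordered) pairs of distinct users and $\mathcal E_{\mathrm a}=\mathcal V_{\mathrm u}\times\mathcal V_{\mathrm a}$; there are no edges between attribute vertices. $G_k(e)\in\{0,1\}$ indicates whether $e$ is an edge of $G_k$. Independently over $e\in\mathcal E_{\mathrm u}\cup\mathcal E_{\mathrm a}$, $\mathsf P((G_1(e),G_2(e))=(a,b))=p_{ab}$ for $e\in\mathcal E_{\mathrm u}$ and $=q_{ab}$ for $e\in\mathcal E_{\mathrm a}$ ($a,b\in\{0,1\}$), where $\bm p=(p_{11},p_{10},p_{01},p_{00})$ and $\bm q=(q_{11},q_{10},q_{01},q_{00})$ are probability vectors. Standing assumption: $G_1(e)$ and $G_2(e)$ are positively correlated for every $e$ (correlation coefficient defined and $>0$). Anonymization: $\Pi^*$ is uniform on the set $\mathcal S_n$ of permutations of $[n]$, independent of $(G_1,G_2)$, and $G_2'$ is obtained from $G_2$ by relabeling each user $i$ as $\Pi^*(i)$ (attribute vertices keep their labels). An estimator is a function $\hat\pi(G_1,G_2')\in\mathcal S_n$. The MAP estimator $\hat\pi_{\mathrm{MAP}}(G_1,G_2')$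 is a maximizer over $\pi\in\mathcal S_n$ of the posterior $\mathsf P(\Pi^*=\pi\mid G_1,G_2')$. $f=O(g)$ means $\limsup_{n\to\infty}|f(n)|/g(n)<\infty$; $f=\Omega(g)$ means $\liminf_{n\to\infty}|f(n)|/g(n)>0$; $f=\Theta(g)$ means both. *)

(* Defs.v *)
From HB Require Import structures.
From mathcomp Require Import all_boot all_order all_algebra all_fingroup.
From mathcomp Require Import all_classical all_reals all_analysis.

Set Implicit Arguments.
Unset Strict Implicit.
Unset Printing Implicit Defensive.

Import Order.TTheory GRing.Theory Num.Theory.
Import numFieldNormedType.Exports.

Local Open Scope classical_set_scope.
Local Open Scope ring_scope.

(** * Discrete probability: [mu] is a probability mass function on [T] *)

Section FiniteProbability.
Context {R : realType} {T : finType}.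
Variable mu : T -> R.

Definition Pr (A : pred T) : R := \sum_(w | A w) mu w.

(* When [Pr B = 0] the value is 0, since [x / 0 = 0]. *)
Definition cPr (A B : pred T) : R := Pr [pred w | A w && B w] / Pr B.

Definition Ex (X : T -> R) : R := \sum_w mu w * X w.

Definition Cov (X Y : T -> R) : R :=
  Ex (fun w => (X w - Ex X) * (Y w - Ex Y)).

Definition Var (X : T -> R) : R := Cov X X.

Definition Corr (X Y : T -> R) : R :=
  Cov X Y / (Num.sqrt (Var X) * Num.sqrt (Var Y)).

(* The conditions on the variances say that [Corr X Y] is defined. *)
Definition positively_correlated (X Y : T -> R) : Prop :=
  [/\ Var X != 0, Var Y != 0 & 0 < Corr X Y].

End FiniteProbability.

(** * Attributed graphs on users ['I_n] and attributes ['I_m] *)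

Definition user_pair (n : nat) := {e : {set 'I_n} | #|e| == 2%N}.

(* [inl] : an unordered pair of distinct users; [inr] : a user-attribute pair *)
Definition edge (n m : nat) := (user_pair n + 'I_n * 'I_m)%type.

Definition graph (n m : nat) := {ffun edge n m -> bool}.

Lemma move_pair_subproof (n : nat) (pi : 'S_n) (e : user_pair n) :
  #|pi @: val e| == 2%N.
Proof. by rewrite card_imset; [exact: (valP e) | exact: perm_inj]. Qed.

Definition move_pair (n : nat) (pi : 'S_n) (e : user_pair n) : user_pair n :=
  exist _ (pi @: val e) (move_pair_subproof pi e).

Definition move_edge (n m : nat) (pi : 'S_n) (e : edge n m) : edge n m :=
  match e with
  | inl e => inl (move_pair pi e)
  | inr (i, a) => inr (pi i, a)
  end.

(* The graph [g] in which every user [i] has been renamed [pi i]. *)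
Definition relabel (n m : nat) (pi : 'S_n) (g : graph n m) : graph n m :=
  [ffun e => g (move_edge pi^-1%g e)].

Lemma relabelE (n m : nat) (pi : 'S_n) (g : graph n m) (e : edge n m) :
  relabel pi g (move_edge pi e) = g e.
Proof.
rewrite ffunE; congr (g _); case: e => [e|[i a]] /=; last by rewrite permK.
congr inl; apply: val_inj => /=; rewrite -imset_comp -[RHS]imset_id.
by apply: eq_imset => i /=; rewrite permK.
Qed.

(** * The attributed Erdos-Renyi pair and its anonymization *)

Section Model.
Context {R : realType}.

(* [subsample p s1 s2 a b] is the probability that the two indicators are
   [(a, b)]: a parent edge is present with probability [p] and is then kept
   in the first (second) graph independently with probability [s1] ([s2]). *)
Definition subsample (p s1 s2 : R) (a b : bool) : R :=
  match a, b with
  | true, true => p * s1 * s2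
  | true, false => p * s1 * (1 - s2)
  | false, true => p * (1 - s1) * s2
  | false, false => p * (1 - s1) * (1 - s2) + 1 - p
  end.

Variables (n m : nat).

(* [pp a b] and [qq a b] stand for p_ab and q_ab. *)
Variables (pp qq : bool -> bool -> R).

Definition edge_law (e : edge n m) : bool -> bool -> R :=
  match e with inl _ => pp | inr _ => qq end.

Definition pair_law (g : graph n m * graph n m) : R :=
  \prod_(e : edge n m) edge_law e (g.1 e) (g.2 e).

Definition outcome : Type := (graph n m * graph n m * 'S_n)%type.
Definition G1 (w : outcome) : graph n m := w.1.1.
Definition G2 (w : outcome) : graph n m := w.1.2.
Definition Pistar (w : outcome) : 'S_n := w.2.
Definition G2' (w : outcome) : graph n m := relabel (Pistar w) (G2 w).

(* [Pistar] is uniform and independent of [(G1, G2)]. *)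
Definition law (w : outcome) : R := pair_law (G1 w, G2 w) / #|{: 'S_n}|%:R.

Definition edges_positively_correlated : Prop :=
  forall e : edge n m,
    positively_correlated law (fun w => (G1 w e)%:R) (fun w => (G2 w e)%:R).

Definition estimator : Type := graph n m -> graph n m -> 'S_n.

Definition posterior (pi : 'S_n) (g1 g2' : graph n m) : R :=
  cPr law [pred w | Pistar w == pi] [pred w | (G1 w == g1) && (G2' w == g2')].

(* Ties may be broken arbitrarily, and nothing is required at observations of
   probability zero, where all the values of [posterior] are 0. *)
Definition is_MAP (est : estimator) : Prop :=
  forall g1 g2' pi, posterior pi g1 g2' <= posterior (est g1 g2') g1 g2'.

Definition error_prob (est : estimator) : R :=
  Pr law [pred w | est (G1 w) (G2' w) != Pistar w].

End Model.

(** * Asymptotics *)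

(* A quotient with zero denominator is 0, so [liminfOmega f g] forces [g] to be
   nonzero eventually. With [g n] of the form [h n / (m n)%:R], it thus forces
   [m n] to be positive eventually. *)
Section Asymptotics.
Context {R : realType}.
Implicit Types f g : nat -> R.
Local Open Scope ereal_scope.

Definition limsupO f g : Prop :=
  limn_esup (fun n => (`|f n| / g n)%R%:E) < +oo.

Definition liminfOmega f g : Prop :=
  0 < limn_einf (fun n => (`|f n| / g n)%R%:E).

Definition limTheta f g : Prop := limsupO f g /\ liminfOmega f g.

End Asymptotics.

(* Main.v *)
(* Write k for the number of users moved by a relabelling s. The probability that
   s is at least as likely as the truth is at most the Bhattacharyya affinity of
   the two likelihoods, a sum over pairs of graphs which factors along the cycles
   of s on the edges; the Cauchy-Schwarz inequality bounds it by
   exp (- psi_u * #(moved user pairs) - psi_a * k * m), where psi_u and psi_a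
   are p_11 and q_11 up to constants, and up to a factor 1 - o(1) when p and q
   tend to 0. If n * p_11 or m * q_11 exceeds a large multiple of log n, the union
   bound over s concludes. Otherwise p = O(1 / log^3 n) and q = O(1 / log^2 n), and
   the union bound still works when k * p_11 is bounded, since about k * n user
   pairs are moved. For larger k this count can be as small as k * n / 2; one
   then first discards the event that some set of k users touches fewer than
   k * n * p_11 / 16 common edges, and on the complement the affinity may be
   multiplied by an exponential weight in that number, which gains the factor
   exp (- k * n * p_11) that is needed.

   For the converse, swapping two users which are isolated in the intersection of
   the two graphs does not decrease the likelihood, and below the threshold there
   are at least two such users with high probability, by Chebyshev's inequality. *)

Require Import Defs.
From mathcomp Require Import all_boot all_order all_algebra all_fingroup.
From mathcomp Require Import all_classical all_reals all_analysis.
From mathcomp Require Import ring lra.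

Set Implicit Arguments.
Unset Strict Implicit.
Unset Printing Implicit Defensive.

Import Order.TTheory GRing.Theory Num.Theory.
Import numFieldNormedType.Exports.

Local Open Scope classical_set_scope.
Local Open Scope ring_scope.

(** * Cauchy-Schwarz along a permutation *)

(** After squaring and symmetrizing the double sum, the difference of the two sides is a sum of
    squares, as in Lagrange's identity. *)
Lemma Cauchy_Schwarz_sqrt (R : rcfType) (I : finType) (u v : I -> R) :
  (forall i, 0 <= u i) -> (forall i, 0 <= v i) ->
  \sum_i Num.sqrt (u i) * Num.sqrt (v i) <=
  Num.sqrt (\sum_i u i) * Num.sqrt (\sum_i v i).
Proof.
move=> u0 v0.
rewrite -sqrtrM ?sumr_ge0// -[leLHS]ger0_norm; last first.
  by rewrite sumr_ge0// => i _; rewrite mulr_ge0 ?sqrtr_ge0.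
rewrite -sqrtr_sqr ler_wsqrtr// expr2 !big_distrlr/=.
rewrite -(ler_pM2l (ltr0n _ 2)) !mulr_natl !mulr2n.
rewrite [X in _ <= X + _]exchange_big/= -!big_split/= ler_sum// => i _.
rewrite -!big_split/= ler_sum// => j _.
set a := Num.sqrt (u i); set b := Num.sqrt (v i).
set c := Num.sqrt (u j); set d := Num.sqrt (v j).
rewrite -(sqr_sqrtr (u0 i)) -(sqr_sqrtr (u0 j)).
rewrite -(sqr_sqrtr (v0 i)) -(sqr_sqrtr (v0 j)) -/a -/b -/c -/d.
have := sqr_ge0 (a * d - c * b); lra.
Qed.

Section Overlap.
Context {R : realType} {E : finType}.
Variables (f : E -> bool -> bool -> R) (s t : E -> E).
Hypothesis f0 : forall e b c, 0 <= f e b c.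
Hypotheses (sK : cancel s t) (tK : cancel t s).

(** The bound for the factor of [e] once the indicators on [S] are summed out, those outside [S]
    being frozen at [b] and [c]. It interpolates between the value of [f e] for empty [S] and the
    factors of the final bound for full [S]. *)
Let N (S : seq E) (e : E) (b c : bool) : R :=
  if s e == e then \sum_(b' | (e \in S) || (b' == b)) f e b' b'
  else Num.sqrt (\sum_(b' | (e \in S) || (b' == b))
                 \sum_(c' | (s e \in S) || (c' == c)) f e b' c' ^+ 2).

Let N_ge0 S e b c : 0 <= N S e b c.
Proof. by rewrite /N; case: ifP => _; [rewrite sumr_ge0 | rewrite sqrtr_ge0]. Qed.

Let upd (h : {ffun E -> bool}) x b : {ffun E -> bool} :=
  [ffun y => if y == x then b else h y].

(** Only the factors at [x] and [t x] see the indicator at [x]. If [x] is fixed they are one factor,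
    which absorbs the sum; otherwise the indicator is the first argument of one and the second
    argument of the other, and Cauchy-Schwarz separates them. *)
Let N_step S x h : x \notin S ->
  \sum_b \prod_e N S e (upd h x b e) (upd h x b (s e)) <=
  \prod_e N (x :: S) e (h e) (h (s e)).
Proof.
move=> xS.
have Nrest e b : e != x -> s e != x ->
    N S e (upd h x b e) (upd h x b (s e)) = N (x :: S) e (h e) (h (s e)).
  by move=> ex sex; rewrite /N /upd !ffunE !inE (negPf ex) (negPf sex).
have [sx|sx] := eqVneq (s x) x.
  rewrite (bigD1 x)//=; under eq_bigr => b _.
    rewrite (bigD1 x)//= (eq_bigr (fun e => N (x :: S) e (h e) (h (s e)))); last first.
      move=> e ex; rewrite Nrest//.
      by apply: contraNneq ex => se; apply/eqP/(can_inj sK); rewrite se sx.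
    over.
  rewrite -big_distrl/= ler_wpM2r//; first by rewrite prodr_ge0.
  rewrite /N sx eqxx inE eqxx/= (negPf xS)/=.
  by rewrite [leRHS](eq_bigl xpredT)//; apply: ler_sum => b _;
     rewrite /upd ffunE eqxx big_pred1_eq.
have tx : t x != x by apply: contraNneq sx => {1}<-; rewrite tK.
rewrite (bigD1 x)// (bigD1 (t x))//=; under eq_bigr => b _.
  rewrite (bigD1 x)// (bigD1 (t x))//= mulrA.
  rewrite (eq_bigr (fun e => N (x :: S) e (h e) (h (s e)))); last first.
    move=> e /andP[ex et]; rewrite Nrest//.
    by apply: contraNneq et => <-; rewrite sK.
  over.
rewrite -big_distrl/= mulrA ler_wpM2r//; first by rewrite prodr_ge0.
rewrite /N (negPf sx) tK eq_sym (negPf tx) !inE eqxx/= (negPf sx) (negPf xS)/=.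
rewrite (negPf tx)/=.
under eq_bigr => b _ do rewrite !ffunE eqxx (negPf sx) (negPf tx) big_pred1_eq.
rewrite [X in _ <= Num.sqrt X * _](eq_bigl xpredT)//.
rewrite [X in _ <= _ * Num.sqrt X]exchange_big/=.
rewrite [X in _ <= _ * Num.sqrt X](eq_bigl xpredT)//.
apply: le_trans (Cauchy_Schwarz_sqrt _ _); last 2 first.
- by move=> b; rewrite sumr_ge0// => c _; rewrite sqr_ge0.
- by move=> b; rewrite sumr_ge0// => c _; rewrite sqr_ge0.
apply: ler_sum => b _; rewrite ler_wpM2l ?sqrtr_ge0// ler_sqrt.
  by apply: ler_sum => c _; rewrite big_pred1_eq.
by rewrite sumr_ge0// => c _; rewrite sqr_ge0.
Qed.

Let sum_upd (G : {ffun E -> bool} -> R) (S : seq E) x (h : {ffun E -> bool}) : x \notin S ->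
  \sum_(g : {ffun E -> bool} | [forall y, (y \in x :: S) || (g y == h y)]) G g =
  \sum_b \sum_(g : {ffun E -> bool} | [forall y, (y \in S) || (g y == upd h x b y)]) G g.
Proof.
move=> xS; rewrite (partition_big (fun g : {ffun E -> bool} => g x) xpredT)//=.
apply: eq_bigr => b _; apply: eq_bigl => g.
apply/andP/forallP => [[/forallP gS /eqP gx] y|gS].
  rewrite ffunE; have := gS y; rewrite inE.
  by case: (eqVneq y x) => [->|]//=; rewrite gx eqxx orbT.
split; last by have := gS x; rewrite (negPf xS) ffunE eqxx.
apply/forallP => y; have := gS y; rewrite inE ffunE.
by case: (eqVneq y x).
Qed.

Let partial_overlap S (h : {ffun E -> bool}) : uniq S ->
  \sum_(g : {ffun E -> bool} | [forall y, (y \in S) || (g y == h y)])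
     \prod_e f e (g e) (g (s e)) <= \prod_e N S e (h e) (h (s e)).
Proof.
elim: S h => [|x S IH] h /=.
  move=> _; rewrite (eq_bigl (pred1 h)) => [|g]; last first.
    apply/forallP/eqP => [gh|-> y]; last by rewrite eqxx.
    by apply/ffunP => y; exact/eqP/(gh y).
  rewrite big_pred1_eq ler_prod// => e _; rewrite f0/= /N.
  case: eqP => [->|_]; first by rewrite big_pred1_eq.
  by rewrite !big_pred1_eq sqrtr_sqr ger0_norm.
case/andP => xS uS; rewrite sum_upd//.
apply: le_trans (N_step _ xS).
by apply: ler_sum => b _; exact: IH.
Qed.

(* Each indicator [h x] occurs in at most two factors, so that summing the
   indicators out one at a time costs one Cauchy-Schwarz inequality each. *)
Lemma sum_prod_perm_le :
  \sum_(h : {ffun E -> bool}) \prod_e f e (h e) (h (s e)) <=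
  \prod_e (if s e == e then \sum_b f e b b
           else Num.sqrt (\sum_b \sum_c f e b c ^+ 2)).
Proof.
rewrite [leLHS](eq_bigl (fun g : {ffun E -> bool} =>
  [forall y, (y \in enum E) || (g y == [ffun=> true] y)])); last first.
  by move=> g; apply/esym/forallP => y; rewrite mem_enum.
apply: le_trans (partial_overlap [ffun=> true] (enum_uniq E)) _.
rewrite le_eqVlt; apply/orP; left; apply/eqP/eq_bigr => e _.
by rewrite /N !mem_enum.
Qed.

End Overlap.

(** * Likelihood of a relabelling *)

Section PairSums.
Context {R : realType} {E : finType}.
Implicit Types A B F : E -> bool -> bool -> R.

Lemma sum_pair_prod F :
  \sum_(g : {ffun E -> bool} * {ffun E -> bool}) \prod_e F e (g.1 e) (g.2 e) =
  \prod_e \sum_a \sum_b F e a b.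
Proof.
rewrite bigA_distr_bigA/=.
rewrite -(pair_bigA _ (fun g1 g2 : {ffun E -> bool} =>
  \prod_e F e (g1 e) (g2 e)))/=.
by apply: eq_bigr => g1 _; rewrite bigA_distr_bigA.
Qed.

(** For fixed [g.2] the sum over [g.1] factors over the edges; what remains is a sum over [g.2]
    alone, with interactions along [s]. *)
Lemma sum_pair_perm_le A B (s t : E -> E) :
  (forall e a b, 0 <= A e a b) -> (forall e a b, 0 <= B e a b) ->
  cancel s t -> cancel t s ->
  \sum_(g : {ffun E -> bool} * {ffun E -> bool})
    \prod_e (A e (g.1 e) (g.2 e) * B e (g.1 e) (g.2 (s e))) <=
  \prod_e (if s e == e then \sum_b \sum_a A e a b * B e a b
           else Num.sqrt (\sum_b \sum_c (\sum_a A e a b * B e a c) ^+ 2)).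
Proof.
move=> A0 B0 sK tK.
rewrite -(pair_bigA _ (fun g1 g2 : {ffun E -> bool} =>
  \prod_e (A e (g1 e) (g2 e) * B e (g1 e) (g2 (s e)))))/= exchange_big/=.
under eq_bigr => g2 _ do rewrite -(bigA_distr_bigA
  (fun e a => A e a (g2 e) * B e a (g2 (s e)))).
apply: (sum_prod_perm_le (f := fun e b c => \sum_a A e a b * B e a c)) sK tK.
by move=> e b c; rewrite sumr_ge0// => a _; rewrite mulr_ge0.
Qed.

End PairSums.

(** * Action of the relabellings on edges and graphs *)

Lemma move_edge1 n m (e : edge n m) : move_edge 1%g e = e.
Proof.
case: e => [e|[i a]]/=; last by rewrite perm1.
congr inl; apply: val_inj => /=; rewrite -[RHS]imset_id.
by apply: eq_imset => i; rewrite perm1.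
Qed.

Lemma move_edgeM n m (s t : 'S_n) (e : edge n m) :
  move_edge (s * t)%g e = move_edge t (move_edge s e).
Proof.
case: e => [e|[i a]]/=; last by rewrite permM.
congr inl; apply: val_inj => /=; rewrite -imset_comp.
by apply: eq_imset => i; rewrite /= permM.
Qed.

Lemma move_edgeK n m (s : 'S_n) :
  cancel (@move_edge n m s) (move_edge s^-1%g).
Proof. by move=> e; rewrite -move_edgeM mulgV move_edge1. Qed.

Lemma move_edgeVK n m (s : 'S_n) :
  cancel (@move_edge n m s^-1%g) (move_edge s).
Proof. by move=> e; rewrite -move_edgeM mulVg move_edge1. Qed.

Lemma relabel1 n m (g : graph n m) : relabel 1%g g = g.
Proof. by apply/ffunP => e; rewrite ffunE invg1 move_edge1. Qed.

Lemma relabelM n m (s t : 'S_n) (g : graph n m) :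
  relabel (s * t)%g g = relabel t (relabel s g).
Proof. by apply/ffunP => e; rewrite !ffunE invMg move_edgeM. Qed.

Section Likelihood.
Context {R : realType} (n m : nat) (pp qq : bool -> bool -> R).
Hypotheses (pp0 : forall a b, 0 <= pp a b) (qq0 : forall a b, 0 <= qq a b).
Local Notation PL := (pair_law (n := n) (m := m) pp qq).

Lemma edge_law_ge0 (e : edge n m) a b : 0 <= edge_law pp qq e a b.
Proof. by case: e => /=. Qed.

Lemma pair_law_ge0 g : 0 <= PL g.
Proof. by rewrite prodr_ge0// => e _; exact: edge_law_ge0. Qed.

Lemma law_ge0 (w : outcome n m) : 0 <= law pp qq w.
Proof. by rewrite divr_ge0 ?pair_law_ge0. Qed.

Lemma edge_law_move (s : 'S_n) (e : edge n m) :
  edge_law pp qq (move_edge s e) = edge_law pp qq e.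
Proof. by case: e => // -[]. Qed.

Lemma card_Sn_gt0 : 0 < #|{: 'S_n}|%:R :> R.
Proof. by rewrite ltr0n; apply/card_gt0P; exists 1%g. Qed.

Lemma sum_law (F : graph n m * graph n m -> R) :
  \sum_(w : outcome n m) law pp qq w * F w.1 = \sum_g PL g * F g.
Proof.
rewrite -(pair_bigA _ (fun g (s : 'S_n) => law pp qq (g, s) * F g))/=.
apply: eq_bigr => -[g1 g2] _; rewrite /law /G1 /G2/= sumr_const.
by rewrite -mulrnAl -[X in X * _]mulr_natr divfK// gt_eqF// card_Sn_gt0.
Qed.

(** The observation and the permutation determine the second graph, so the event is a single
    outcome. *)
Lemma Pr_estimate_observed (s : 'S_n) (g1 h : graph n m) :
  Pr (law pp qq)
     [pred w | (Pistar w == s) && ((G1 w == g1) && (G2' w == h))] =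
  law pp qq (g1, relabel s^-1%g h, s).
Proof.
rewrite /Pr (eq_bigl (pred1 (g1, relabel s^-1%g h, s))) ?big_pred1_eq//.
move=> [[a b] t]; rewrite /= /G1 /Pistar /G2' /G2/= !xpair_eqE.
apply/and3P/andP => [[/eqP-> /eqP-> /eqP<-]|[/andP[/eqP-> /eqP->] /eqP->]].
  by rewrite -relabelM mulgV relabel1 !eqxx.
by rewrite -relabelM mulVg relabel1 !eqxx.
Qed.

(** Ties count as failures, which covers every way of breaking them in [is_MAP]. *)
Definition fooled (s : 'S_n) (g : graph n m * graph n m) : bool :=
  PL g <= PL (g.1, relabel s g.2).

(** In the comparison of the two posteriors the probability of the observation and the uniform prior
    cancel, which leaves a comparison of likelihoods of graph pairs. *)
Lemma MAP_error_le (est : estimator n m) : is_MAP pp qq est ->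
  error_prob pp qq est <=
  \sum_(g | [exists s : 'S_n, (s != 1%g) && fooled s g]) PL g.
Proof.
move=> MAP; pose F g : R := ([exists s : 'S_n, (s != 1%g) && fooled s g])%:R.
rewrite [leRHS]big_mkcond (eq_bigr (fun g => PL g * F g)); last first.
  by move=> g _; rewrite /F; case: ifP; rewrite (mulr1, mulr0).
rewrite -sum_law /error_prob /Pr big_mkcond ler_sum// => w _.
case: ifP => [wrong|_]; last by rewrite mulr_ge0 ?law_ge0.
(* At a null outcome the observation may have probability zero, and maximality of the posterior then
   says nothing. *)
have [->|law_neq0] := eqVneq (law pp qq w) 0; first by rewrite mul0r.
have law_gt0 : 0 < law pp qq w by rewrite lt_def law_neq0 law_ge0.
suff -> : F w.1 = 1 by rewrite mulr1.
rewrite /F (_ : [exists s, _] = true)//; apply/existsP.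
case: w wrong law_neq0 law_gt0 => [[g1 g2] s] /=.
rewrite /G1 /G2' /G2 /Pistar/=; set h := relabel s g2; set s' := est g1 h.
move=> wrong law_neq0 law_gt0.
(* Relabelling by the truth and then back by the estimate yields the second graph that the estimate
   stands for. *)
exists (s * s'^-1)%g; apply/andP; split.
  by apply: contra wrong; rewrite -eq_mulgV1 eq_sym.
have := MAP g1 h s; rewrite /posterior /cPr -/s' ler_pM2r; last first.
  rewrite invr_gt0 /Pr (bigD1 (g1, g2, s))/=.
    by rewrite ltr_pwDl// sumr_ge0// => w _; exact: law_ge0.
  by rewrite /G1 /G2' /Pistar/= !eqxx.
rewrite !Pr_estimate_observed /law ler_pM2r ?invr_gt0 ?card_Sn_gt0//.
by rewrite /fooled/= relabelM -/h /G1 /G2/= /h -relabelM mulgV relabel1.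
Qed.

End Likelihood.

(** * Pairs moved by a relabelling *)

Definition touches n m (S : {set 'I_n}) (e : edge n m) : bool :=
  match e with
  | inl e => ~~ [disjoint val e & S]
  | inr (i, _) => i \in S
  end.

Definition touching_pairs n (S : {set 'I_n}) : {set user_pair n} :=
  [set e : user_pair n | ~~ [disjoint val e & S]].

Definition moved n (s : 'S_n) : {set 'I_n} := [set i | s i != i].

Lemma card_user_pairs n (P : pred {set 'I_n}) :
  #|[set e : user_pair n | P (val e)]%SET| = #|[set A : {set 'I_n} | P A & #|A| == 2%N]%SET|.
Proof.
rewrite -(card_imset _ val_inj); apply: eq_card => A; rewrite inE.
apply/imsetP/andP => [[e]|[PA A2]].
  by rewrite inE => Pe ->; split=> //; exact: (valP e).
by exists (exist _ A A2 : user_pair n); rewrite ?inE.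
Qed.

Lemma card_touching_pairs n (S : {set 'I_n}) :
  (#|touching_pairs S| + 'C(n - #|S|, 2) = 'C(n, 2))%N.
Proof.
have -> : 'C(n - #|S|, 2) = #|~: touching_pairs S|.
  rewrite (_ : ~: _ = [set e : user_pair n | val e \subset ~: S]%SET); last first.
    by apply/setP => e; rewrite !inE negbK finset.disjoints_subset.
  rewrite (card_user_pairs (fun A => A \subset ~: S)) cards_draws.
  by rewrite [X in _ = 'C(X, _)]cardsCs finset.setCK card_ord.
rewrite cardsC -cardsT.
rewrite (_ : [set: _]%SET = [set e : user_pair n | val e \subset [set: 'I_n]%SET]%SET); last first.
  by apply/setP => e; rewrite !inE finset.subsetT.
by rewrite (card_user_pairs (fun A => A \subset [set: _]%SET)) cards_draws cardsT card_ord.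
Qed.

(** Doubling turns the binomials into the polynomials [j * (j - 1)]. *)
Lemma card_touching_pairs_double (R : realType) n (S : {set 'I_n}) :
  #|touching_pairs S|%:R * 2 = #|S|%:R * (2 * n%:R - #|S|%:R - 1) :> R.
Proof.
have kn : (#|S| <= n)%N by rewrite -[leqRHS]card_ord max_card.
have bin2R j : ('C(j, 2))%:R * 2 = j%:R * (j%:R - 1) :> R.
  case: j => [|j]; first by rewrite bin0n !mul0r.
  rewrite -natrM muln2 bin2 /= -[j.+1%:R in RHS]natr1 addrK natr1 -natrM.
  have := odd_double_half (j.+1 * j); rewrite oddM/= andNb add0n => ->.
  by [].
have := card_touching_pairs S => /(congr1 (fun j => j%:R * 2 : R)).
rewrite natrD mulrDl !bin2R natrB// => h.
by rewrite -[LHS](addrK ((n%:R - #|S|%:R) * (n%:R - #|S|%:R - 1))) h; ring.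
Qed.

(** A fixed pair that contains a moved user [i] also contains [s i], so it is the pair of these two
    and is determined by [i]. *)
Lemma card_fixed_touching_pairs n (s : 'S_n) :
  (#|[set e in touching_pairs (moved s) | move_pair s e == e]%SET| <= #|moved s|)%N.
Proof.
rewrite -(card_imset _ val_inj).
apply: leq_trans (leq_imset_card (fun i => [set i; s i]%SET) (moved s)).
apply/subset_leq_card/fintype.subsetP => A /imsetP[e].
rewrite !inE => /andP[/pred0Pn[i /= /andP[ie iS]] /eqP fix_e] ->.
apply/imsetP; exists i => //; move: iS; rewrite inE => si.
have se : s i \in val e by rewrite -fix_e; apply/imsetP; exists i.
apply/esym/eqP; rewrite eqEcard cards2 eq_sym si (eqP (valP e)) andbT.
by apply/fintype.subsetP => j; rewrite !inE => /orP[]/eqP->.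
Qed.

Lemma move_pair_untouched n (s : 'S_n) (e : user_pair n) :
  e \notin touching_pairs (moved s) -> move_pair s e = e.
Proof.
rewrite inE negbK => /pred0P dis; apply: val_inj => /=.
rewrite -[RHS]imset_id; apply: eq_in_imset => i ie.
by have := dis i; rewrite /= ie inE => /negbT; rewrite negbK => /eqP.
Qed.

Section EdgeProducts.
Context {R : realType} (n m : nat).

Lemma prod_touching (S : {set 'I_n}) (u v : R) :
  \prod_(e : edge n m)
    (if touches S e then match e with inl _ => u | inr _ => v end else 1) =
  u ^+ #|touching_pairs S| * v ^+ (#|S| * m).
Proof.
rewrite big_sumType/=; congr (_ * _).
  by rewrite -big_mkcond/= prodr_const; congr (_ ^+ _); apply: eq_card => e; rewrite !inE.
rewrite (eq_bigr (fun x : 'I_n * 'I_m => if x.1 \in S then v else 1)); last first.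
  by case.
rewrite -(pair_bigA _ (fun i (_ : 'I_m) => if i \in S then v else 1))/=.
rewrite (eq_bigr (fun i => if i \in S then v ^+ m else 1)) => [|i _].
  by rewrite -big_mkcond/= prodr_const -exprM mulnC.
by rewrite prodr_const card_ord; case: ifP; rewrite ?expr1n.
Qed.

(* The bound for an arbitrary [s] replaces the number of fixed touching pairs,
   which depends on the 2-cycles of [s], by the number of moved users. *)
Lemma prod_move_le (s : 'S_n) (x y v : R) :
  1 <= x -> 0 <= y <= 1 -> 0 <= v ->
  \prod_(e : edge n m)
    (if move_edge s e == e then
       match e with
       | inl _ => if touches (moved s) e then x else 1 | inr _ => 1 end
     else match e with inl _ => y | inr _ => v end) <=
  x ^+ #|moved s| * y ^+ (#|touching_pairs (moved s)| - #|moved s|) *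
  v ^+ (#|moved s| * m).
Proof.
move=> x1 /andP[y0 y1] v0; rewrite big_sumType/=.
rewrite [X in _ * X](_ : _ = v ^+ (#|moved s| * m)); last first.
  rewrite (eq_bigr (fun x : 'I_n * 'I_m => if x.1 \in moved s then v else 1)); last first.
    move=> [i a] _ /=; rewrite inE.
    rewrite (_ : (_ == _) = (s i == i)); first by case: eqP.
    by apply/eqP/eqP => [[]|->].
  rewrite -(pair_bigA _ (fun i (_ : 'I_m) => if i \in moved s then v else 1))/=.
  rewrite (eq_bigr (fun i => if i \in moved s then v ^+ m else 1)) => [|i _].
    by rewrite -big_mkcond/= prodr_const -exprM mulnC.
  by rewrite prodr_const card_ord; case: ifP; rewrite ?expr1n.
rewrite ler_wpM2r ?exprn_ge0//.
set T := touching_pairs (moved s).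
set F := [set e in T | move_pair s e == e]%SET.
have FT : F \subset T by apply/fintype.subsetP => e; rewrite inE => /andP[].
have Fk : (#|F| <= #|moved s|)%N by exact: card_fixed_touching_pairs.
rewrite (eq_bigr (fun e => (if e \in F then x else 1) *
                           (if e \in T :\: F then y else 1))); last first.
  move=> e _; rewrite (_ : (_ == _) = (move_pair s e == e)); last first.
    by apply/eqP/eqP => [[]|->].
  rewrite [e \in _ :\: _]inE [e \in F]inE.
  have := @move_pair_untouched _ s e; rewrite -/T.
  have -> : ~~ [disjoint val e & moved s] = (e \in T) by rewrite inE.
  case: (e \in T) => /= [_|->//]; last by rewrite eqxx mulr1.
  by case: eqP => _; rewrite ?mulr1 ?mul1r.
rewrite big_split/= -!big_mkcond/= !prodr_const cardsD (finset.setIidPr FT).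
rewrite ler_pM ?exprn_ge0 ?(le_trans _ x1)//.
  by rewrite ler_weXn2l.
by rewrite ler_wiXn2l// leq_sub2l.
Qed.

End EdgeProducts.

(** * Affinity of the two likelihoods *)

Section Affinity.
Context {R : realType} (P : bool -> bool -> R).
Hypothesis P0 : forall a b, 0 <= P a b.
Hypothesis P1 : \sum_a \sum_b P a b = 1.

(* The squared determinant of the matrix of the [Num.sqrt (P a b)]; the
   squared Frobenius norm of its Gram matrix is [1 - 2 * affinity_gap]. *)
Definition affinity_gap : R :=
  (Num.sqrt (P true true * P false false)
   - Num.sqrt (P true false * P false true)) ^+ 2.

(** Multiplied by [Num.sqrt (P a c)], this is a Bhattacharyya summand in which a common edge carries
    the weight [x]. *)
Definition tilt (x : R) (a b : bool) : R :=
  (if a && b then x else 1) * Num.sqrt (P a b).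

Lemma affinity_gap_ge0 : 0 <= affinity_gap.
Proof. exact: sqr_ge0. Qed.

Lemma tilt_ge0 x a b : 0 <= x -> 0 <= tilt x a b.
Proof. by move=> x0; rewrite mulr_ge0 ?sqrtr_ge0//; case: ifP. Qed.

Lemma trace_tilt x :
  \sum_b \sum_a tilt x a b * Num.sqrt (P a b) = 1 + (x - 1) * P true true.
Proof.
rewrite /tilt !big_bool/= !mul1r -!mulrA -!expr2 !sqr_sqrtr//.
by move: P1; rewrite !big_bool/=; lra.
Qed.

(** A polynomial identity in the four square roots, where the leading [1] stands for the squared
    total mass. Expanding in [x - 1] shows the tilt as a perturbation of [1 - 2 * affinity_gap]. *)
Lemma norm_tilt x :
  \sum_b \sum_c (\sum_a tilt x a b * Num.sqrt (P a c)) ^+ 2 =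
  1 - 2 * affinity_gap
  + 2 * (x - 1) * P true true * (P true true + P false true)
  + (x - 1) ^+ 2 * P true true ^+ 2
  + 2 * (x - 1) * (P true true * P true false
      + Num.sqrt (P true true * P false false)
        * Num.sqrt (P true false * P false true))
  + (x - 1) ^+ 2 * (P true true * P true false).
Proof.
move: P1; rewrite /tilt /affinity_gap !big_bool/= !mul1r !sqrtrM//.
move: (sqr_sqrtr (P0 true true)) (sqr_sqrtr (P0 true false)).
move: (sqr_sqrtr (P0 false true)) (sqr_sqrtr (P0 false false)).
set a := Num.sqrt (P true true); set b := Num.sqrt (P true false).
set c := Num.sqrt (P false true); set d := Num.sqrt (P false false).
move=> <- <- <- <- E.
rewrite [X in X - 2 * _](_ : _ = (a ^+ 2 + b ^+ 2 + (c ^+ 2 + d ^+ 2)) ^+ 2).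
  by ring.
by rewrite E expr1n.
Qed.

End Affinity.

Lemma moved_inv n (s : 'S_n) : moved s^-1%g = moved s.
Proof.
apply/setP => i; rewrite !inE; congr negb; apply/eqP/eqP => h.
  by rewrite -{1}h permKV.
by rewrite -{1}h permK.
Qed.

Lemma sqrtr_prod (R : rcfType) (I : Type) (r : seq I) (F : I -> R) :
  (forall i, 0 <= F i) ->
  Num.sqrt (\prod_(i <- r) F i) = \prod_(i <- r) Num.sqrt (F i).
Proof.
move=> F0; elim: r => [|i r IH]; first by rewrite !big_nil sqrtr1.
by rewrite !big_cons sqrtrM// IH.
Qed.

(** * Exponential moments and bounds for a given relabelling or set of moved users *)

Section UnionBound.
Context {R : realType} (n m : nat) (pp qq : bool -> bool -> R).
Hypotheses (pp0 : forall a b, 0 <= pp a b) (qq0 : forall a b, 0 <= qq a b).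
Hypotheses (pp1 : \sum_a \sum_b pp a b = 1) (qq1 : \sum_a \sum_b qq a b = 1).
Local Notation PL := (pair_law (n := n) (m := m) pp qq).

Definition common_pairs (S : {set 'I_n}) (g : graph n m * graph n m) : nat :=
  #|[set e in touching_pairs S | g.1 (inl e) && g.2 (inl e)]%SET|.

Lemma exp_common_pairs (x : R) S g :
  x ^+ common_pairs S g =
  \prod_(e : edge n m)
    match e with
    | inl _ => if touches S e && (g.1 e && g.2 e) then x else 1
    | inr _ => 1
    end.
Proof.
rewrite big_sumType/= [X in _ * X]big1 ?mulr1; last by case.
rewrite -big_mkcond/= prodr_const; congr (_ ^+ _).
by apply: eq_card => e; rewrite !inE.
Qed.

(** The count is binomial, and this is its generating function. *)
Lemma sum_exp_common_pairs (x : R) S :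
  \sum_g PL g * x ^+ common_pairs S g =
  (1 - pp true true * (1 - x)) ^+ #|touching_pairs S|.
Proof.
have -> : (1 - pp true true * (1 - x)) ^+ #|touching_pairs S| =
    (1 - pp true true * (1 - x)) ^+ #|touching_pairs S| * 1 ^+ (#|S| * m).
  by rewrite expr1n mulr1.
rewrite -prod_touching.
under eq_bigr => g _ do rewrite exp_common_pairs -big_split/=.
rewrite (sum_pair_prod (fun (e : edge n m) a b => edge_law pp qq e a b *
  match e with
  | inl _ => if touches S e && (a && b) then x else 1 | inr _ => 1 end)).
apply: eq_bigr => -[e|[i a]] _ /=.
  move: pp1; rewrite !big_bool/= !andbT !andbF /= => pp1'.
  by case: ifP => _; lra.
by move: qq1; rewrite !big_bool/= => qq1'; case: ifP => _; lra.
Qed.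

(** Untouched user pairs are fixed and left untilted, so they contribute total mass 1. Fixed
    touching pairs contribute the trace, moved pairs the norms, and [y <= 1] allows a lower bound on
    the number of moved user pairs. *)
Lemma sum_tilted_affinity_le (s : 'S_n) (x y v : R) :
  1 <= x ->
  Num.sqrt (\sum_b \sum_c
    (\sum_a tilt pp x a b * Num.sqrt (pp a c)) ^+ 2) <= y <= 1 ->
  Num.sqrt (\sum_b \sum_c
    (\sum_a tilt qq 1 a b * Num.sqrt (qq a c)) ^+ 2) <= v ->
  \sum_g x ^+ common_pairs (moved s) g
         * Num.sqrt (PL g * PL (g.1, relabel s g.2)) <=
  (1 + (x - 1) * pp true true) ^+ #|moved s|
  * y ^+ (#|touching_pairs (moved s)| - #|moved s|) * v ^+ (#|moved s| * m).
Proof.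
move=> x1 /andP[ylow y1] vlow; have x0 : 0 <= x by rewrite (le_trans _ x1).
pose W (e : edge n m) := edge_law pp qq e.
pose A (e : edge n m) a b : R :=
  match e with
  | inl _ => if touches (moved s) e then tilt pp x a b else Num.sqrt (pp a b)
  | inr _ => tilt qq 1 a b
  end.
pose B (e : edge n m) a b : R := Num.sqrt (W e a b).
have A0 e a b : 0 <= A e a b.
  by case: e => [e|?] /=; [case: ifP => _|]; rewrite ?tilt_ge0 ?sqrtr_ge0.
have B0 e a b : 0 <= B e a b by rewrite sqrtr_ge0.
(* [relabel] reads [g.2] at the preimage of an edge, so the edge permutation is that of [s^-1],
   which moves the same users. *)
rewrite (eq_bigr (fun g : graph n m * graph n m => \prod_e
    (A e (g.1 e) (g.2 e) * B e (g.1 e) (g.2 (move_edge s^-1%g e))))); last first.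
  move=> g _; rewrite exp_common_pairs sqrtrM ?pair_law_ge0// /pair_law.
  rewrite !sqrtr_prod; do ?[by move=> e; exact: edge_law_ge0].
  rewrite -!big_split/=; apply: eq_bigr => -[e|[i a]] _ /=.
    rewrite ffunE /B /W /tilt /=.
    by case: (~~ [disjoint _ & _]); rewrite /= ?mul1r ?mulrA.
  by rewrite ffunE /B /W /tilt /= if_same !mul1r.
apply: le_trans (sum_pair_perm_le A0 B0 (@move_edgeVK n m s) (@move_edgeK n m s)) _.
rewrite -moved_inv; apply: le_trans (prod_move_le _ _ _ _ _); last 3 first.
- by rewrite lerDl mulr_ge0// subr_ge0.
- by rewrite y1 (le_trans _ ylow)// sqrtr_ge0.
- by rewrite (le_trans _ vlow)// sqrtr_ge0.
apply: ler_prod => e _; apply/andP; split.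
  case: ifP => _; last by rewrite sqrtr_ge0.
  by apply: sumr_ge0 => b _; apply: sumr_ge0 => a _; rewrite mulr_ge0.
rewrite moved_inv.
case: ifP => [fixed|notfixed].
  case: e fixed => [e|[i a]] _; rewrite /B /W/=; last first.
    by rewrite trace_tilt// subrr mul0r addr0.
  case: ifP => _; first by rewrite trace_tilt.
  have := trace_tilt pp0 pp1 1; rewrite subrr mul0r addr0 => <-.
  by apply: ler_sum => b _; apply: ler_sum => a _; rewrite /tilt if_same mul1r.
case: e notfixed => [e|[i a]] notfixed; rewrite /B /W/=; last exact: vlow.
have touch : touches (moved s) (inl e : edge n m).
  apply: contraFT notfixed => /= untouched; apply/eqP; congr inl.
  by apply: move_pair_untouched; rewrite inE moved_inv.
by rewrite /= in touch; rewrite touch.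
Qed.

Lemma sqrt_norm_le P : (forall a b, 0 <= P a b) -> \sum_a \sum_b P a b = 1 ->
  Num.sqrt (\sum_b \sum_c
    (\sum_a tilt P 1 a b * Num.sqrt (P a c)) ^+ 2) <= expR (- affinity_gap P) :> R.
Proof.
move=> P0 P1; rewrite norm_tilt// subrr expr0n/= !(mulr0, mul0r, addr0).
rewrite -[leRHS]ger0_norm ?expR_ge0// -sqrtr_sqr ler_wsqrtr//.
rewrite expr2 -expRD; apply: le_trans (expR_ge1Dx _); lra.
Qed.

(** Where [s] fools, [PL g] is at most the geometric mean of the two likelihoods; the tilt is
    trivial. *)
Lemma sum_fooled_le (s : 'S_n) :
  \sum_(g | fooled pp qq s g) PL g <=
  expR (- affinity_gap pp * (#|touching_pairs (moved s)|%:R - #|moved s|%:R)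
        - affinity_gap qq * (#|moved s| * m)%:R).
Proof.
have := @sum_tilted_affinity_le s 1 (expR (- affinity_gap pp))
  (expR (- affinity_gap qq)) (lexx _).
rewrite sqrt_norm_le//= expR_le1 oppr_le0 affinity_gap_ge0 => /(_ isT).
rewrite sqrt_norm_le// => /(_ isT).
rewrite subrr mul0r addr0 expr1n mul1r -!expRM_natr -expRD => bound.
(* Truncated subtraction is at least the real one, and the gap is nonnegative. *)
apply: (@le_trans _ _ (expR (- affinity_gap pp *
    (#|touching_pairs (moved s)| - #|moved s|)%N%:R
    - affinity_gap qq * (#|moved s| * m)%:R))); last first.
  rewrite ler_expR lerD2r !mulNr lerN2 ler_wpM2l ?affinity_gap_ge0//.
  by rewrite lerBlDr -natrD ler_nat addnC -leq_subLR.
rewrite -[X in _ + X]mulNr; apply: le_trans bound.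
rewrite big_mkcond/= ler_sum// => g _.
case: ifP => [fool|_]; last by rewrite mulr_ge0 ?sqrtr_ge0 ?exprn_ge0.
rewrite expr1n mul1r -[leLHS]ger0_norm ?pair_law_ge0// -sqrtr_sqr.
by rewrite ler_wsqrtr// expr2 ler_wpM2l ?pair_law_ge0.
Qed.

(** A Chernoff bound inside the affinity: the weight [expR (tau * (common_pairs - nu))] is at least
    1 on the event, and the norm hypothesis says that tilting the moved user pairs costs nothing. *)
Lemma sum_fooled_many_common_le (s : 'S_n) (tau nu : R) :
  0 <= tau ->
  \sum_b \sum_c (\sum_a tilt pp (expR tau) a b * Num.sqrt (pp a c)) ^+ 2 <= 1 ->
  \sum_(g | fooled pp qq s g && (nu <= (common_pairs (moved s) g)%:R)) PL g <=
  expR (- (tau * nu) + (expR tau - 1) * pp true true * #|moved s|%:R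
        - affinity_gap qq * (#|moved s| * m)%:R).
Proof.
move=> tau0 norm1; have x1 : 1 <= expR tau by rewrite -expR0 ler_expR.
have := @sum_tilted_affinity_le s (expR tau) 1 (expR (- affinity_gap qq)) x1.
have sqrt1 : Num.sqrt (\sum_b \sum_c
    (\sum_a tilt pp (expR tau) a b * Num.sqrt (pp a c)) ^+ 2) <= 1.
  by rewrite -[leRHS]sqrtr1 ler_wsqrtr.
rewrite sqrt1 lexx => /(_ isT).
rewrite sqrt_norm_le// => /(_ isT); rewrite expr1n mulr1 => bound.
rewrite !expRD -[- (affinity_gap qq * _)]mulNr [X in _ * X]expRM_natr.
apply: le_trans (_ : expR (- (tau * nu)) *
  ((1 + (expR tau - 1) * pp true true) ^+ #|moved s| *
   expR (- affinity_gap qq) ^+ (#|moved s| * m)) <= _); last first.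
  rewrite mulrA ler_wpM2r ?exprn_ge0 ?expR_ge0// ler_wpM2l ?expR_ge0//.
  rewrite expRM_natr lerXn2r ?nnegrE ?expR_ge0 ?expR_ge1Dx//.
  by rewrite addr_ge0// mulr_ge0// subr_ge0.
apply: le_trans (ler_wpM2l (expR_ge0 _) bound).
rewrite mulr_sumr big_mkcond/= ler_sum// => g _.
have term_ge0 : 0 <= expR tau ^+ common_pairs (moved s) g *
    Num.sqrt (PL g * PL (g.1, relabel s g.2)).
  by rewrite mulr_ge0 ?exprn_ge0 ?expR_ge0 ?sqrtr_ge0.
case: ifP => [/andP[fool many]|_]; last by rewrite mulr_ge0 ?expR_ge0.
rewrite mulrA -expRM_natr -expRD.
apply: le_trans (_ : 1 * Num.sqrt (PL g * PL (g.1, relabel s g.2)) <= _).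
  rewrite mul1r -[leLHS]ger0_norm ?pair_law_ge0// -sqrtr_sqr.
  by rewrite ler_wsqrtr// expr2 ler_wpM2l ?pair_law_ge0.
rewrite ler_wpM2r ?sqrtr_ge0// -[leLHS]expR0 ler_expR addrC subr_ge0.
by rewrite ler_wpM2l.
Qed.

(** The Chernoff bound for the lower tail with weight [expR (-1)]; the factor [1 / 2] comes from
    [1 - expR (-1) >= 1 / 2]. *)
Lemma sum_few_common_le S (nu : R) :
  \sum_(g | (common_pairs S g)%:R < nu) PL g <=
  expR (nu - pp true true * #|touching_pairs S|%:R / 2).
Proof.
have e1 : expR (-1) <= 2^-1 :> R.
  by rewrite expRN lef_pV2 ?posrE ?expR_gt0//; have := expR_ge1Dx (1 : R); lra.
have pp_le1 : pp true true <= 1.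
  move: pp1; rewrite !big_bool/= => H.
  by move: (pp0 true false) (pp0 false true) (pp0 false false); lra.
apply: le_trans (_ : expR nu * (1 - pp true true * (1 - expR (-1)))
                     ^+ #|touching_pairs S| <= _); last first.
  rewrite [pp _ _ * _ / _]mulrAC expRD ler_wpM2l ?expR_ge0// -[in leRHS]mulNr expRM_natr.
  rewrite lerXn2r ?nnegrE ?expR_ge0//.
    have := expR_ge0 (-1 : R); move: (pp0 true true) => p0 e0.
    by rewrite subr_ge0 mulr_ile1//; lra.
  apply: le_trans (expR_ge1Dx _); rewrite lerD2l lerN2 ler_wpM2l//; lra.
rewrite -sum_exp_common_pairs mulr_sumr big_mkcond/= ler_sum// => g _.
case: ifP => [few|_]; last first.
  by rewrite !mulr_ge0 ?expR_ge0 ?pair_law_ge0 ?exprn_ge0 ?expR_ge0.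
rewrite mulrCA -expRM_natr -expRD -[leLHS]mulr1 ler_wpM2l ?pair_law_ge0//.
by rewrite -[leLHS]expR0 ler_expR mulN1r subr_ge0 ltW.
Qed.

Definition fooled_moving (S : {set 'I_n}) (g : graph n m * graph n m) : bool :=
  [exists s : 'S_n, (moved s == S) && fooled pp qq s g].

(** The relabellings whose moved set is [S] permute [S], so there are at most [#|S|]! of them. *)
Lemma sum_fooled_moving_le S (Q : pred (graph n m * graph n m)) (B : R) :
  0 <= B -> (forall s, moved s = S -> \sum_(g | fooled pp qq s g && Q g) PL g <= B) ->
  \sum_(g | fooled_moving S g && Q g) PL g <= (#|S|)`!%:R * B.
Proof.
move=> B0 H; apply: (@le_trans _ _ (\sum_(s : 'S_n | moved s == S)
    \sum_(g | fooled pp qq s g && Q g) PL g)).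
  rewrite (exchange_big_dep xpredT)//= big_mkcond ler_sum//= => g _.
  case: ifP => [/andP[/existsP[s /andP[sS fool]] Qg]|_]; last first.
    by rewrite sumr_ge0// => s _; exact: pair_law_ge0.
  rewrite (bigD1 s)/=; last by rewrite sS fool.
  by rewrite lerDl sumr_ge0// => t _; exact: pair_law_ge0.
apply: (@le_trans _ _ (\sum_(s : 'S_n | moved s == S) B)).
  by apply: ler_sum => s /eqP; exact: H.
rewrite sumr_const -[leLHS]mulr_natl ler_wpM2r// ler_nat -card_perm.
apply/subset_leq_card/fintype.subsetP => s s_moves.
have <- : moved s = S by apply/eqP.
by apply/fintype.subsetP => i; rewrite !inE.
Qed.

End UnionBound.

Lemma moved_eq0 n (s : 'S_n) : (moved s == finset.set0) = (s == 1%g).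
Proof.
apply/eqP/eqP => [moved0|->].
  apply/permP => i; rewrite perm1; apply/eqP.
  by have := finset.in_set0 i; rewrite -moved0 inE => /negbT; rewrite negbK.
by apply/setP => i; rewrite !inE perm1 eqxx.
Qed.

Lemma sum_geometric_le (R : realFieldType) (r : R) j :
  0 <= r <= 2^-1 -> \sum_(i < j) r ^+ i <= 2.
Proof.
move=> /andP[r0 r2]; elim: j => [|j IH]; first by rewrite big_ord0.
rewrite big_ord_recl expr0 (eq_bigr (fun i : 'I_j => r * r ^+ i)); last first.
  by move=> i _; rewrite -exprS.
rewrite -mulr_sumr.
have : r * \sum_(i < j) r ^+ i <= 2^-1 * 2.
  by rewrite ler_pM// sumr_ge0// => i _; rewrite exprn_ge0.
lra.
Qed.

(** The number of sets of size [k] times [k]! is a falling factorial, at most [n ^ k]; a geometric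
    series without its constant term remains. *)
Lemma sum_nonempty_sets_le (R : realFieldType) n (r : R) :
  0 <= r <= 2^-1 ->
  \sum_(S : {set 'I_n} | S != finset.set0)
    ((#|S|)`!)%:R * (r / n%:R) ^+ #|S| <= 2 * r.
Proof.
move=> r01; have /andP[r0 r2] := r01.
have cardS (S : {set 'I_n}) : (#|S| < n.+1)%N.
  by rewrite ltnS -[leqRHS]card_ord max_card.
rewrite (partition_big (fun S : {set 'I_n} => inord #|S| : 'I_n.+1)
  (fun k => k != ord0))/=; last first.
  move=> S; apply: contra => /eqP/(congr1 val).
  by rewrite /= inordK// => /eqP; rewrite cards_eq0.
apply: (@le_trans _ _ (\sum_(k < n.+1 | k != ord0) r ^+ k)).
  apply: ler_sum => k k0.
  rewrite (eq_bigl (fun S : {set 'I_n} => (S \subset [set: 'I_n]%SET) && (#|S| == k)))%N.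
    rewrite (eq_bigr (fun _ => (k`!)%:R * (r / n%:R) ^+ k)); last first.
      by move=> S /andP[_ /eqP->].
    rewrite -big_set/= sumr_const cards_draws cardsT card_ord -[leLHS]mulr_natl mulrA.
    rewrite -natrM bin_ffact expr_div_n mulrCA ler_piMr ?exprn_ge0//.
    have n0 : (0 < n)%N.
      by rewrite (leq_trans _ (ltn_ord k : (k <= n)%N))// lt0n.
    rewrite ler_pdivrMr ?exprn_gt0 ?ltr0n// mul1r -natrX ler_nat.
    rewrite ffact_prod -[k in (n ^ k)%N]card_ord -prod_nat_const.
    by apply: leq_prod => i _; exact: leq_subr.
  move=> S; rewrite finset.subsetT/= -cards_eq0; apply/andP/eqP.
    by move=> [_ /eqP/(congr1 val)]; rewrite /= inordK.
  move=> Sk; split; first by rewrite Sk.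
  by apply/eqP/val_inj; rewrite /= inordK.
rewrite big_mkcond big_ord_recl/= add0r.
rewrite (eq_bigr (fun i : 'I_n => r * r ^+ i)); last by move=> i _; rewrite -exprS.
by rewrite -mulr_sumr mulrC ler_wpM2r// sum_geometric_le.
Qed.

(** The union bound runs over moved sets. The part [D] of the error, which does not depend on the
    relabelling, is thus paid once for each of at most [2 ^ n] sets and escapes the factorial. *)
Lemma exists_fooled_le (R : realType) n m (pp qq : bool -> bool -> R) (r D : R) :
  (forall a b, 0 <= pp a b) -> (forall a b, 0 <= qq a b) ->
  0 <= r <= 2^-1 -> 0 <= D ->
  (forall S : {set 'I_n}, S != finset.set0 ->
    \sum_(g : graph n m * graph n m | fooled_moving pp qq S g) pair_law pp qq g
    <= D + ((#|S|)`!)%:R * (r / n%:R) ^+ #|S|) ->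
  \sum_(g : graph n m * graph n m |
        [exists s : 'S_n, (s != 1%g) && fooled pp qq s g]) pair_law pp qq g
  <= 2 ^+ n * D + 2 * r.
Proof.
move=> pp0 qq0 r01 D0 H.
have PL0 g : 0 <= pair_law (n := n) (m := m) pp qq g by exact: pair_law_ge0.
apply: (@le_trans _ _ (\sum_(S : {set 'I_n} | S != finset.set0)
   \sum_(g : graph n m * graph n m | fooled_moving pp qq S g) pair_law pp qq g)).
  rewrite (exchange_big_dep xpredT)//= big_mkcond ler_sum//= => g _.
  case: ifP => [/existsP[s /andP[s1 fool]]|_]; last by rewrite sumr_ge0.
  rewrite (bigD1 (moved s))/=; first by rewrite lerDl sumr_ge0.
  by rewrite moved_eq0 s1; apply/existsP; exists s; rewrite eqxx.
apply: le_trans (ler_sum _ H) _; rewrite big_split/=.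
rewrite lerD ?sum_nonempty_sets_le// sumr_const -[leLHS]mulr_natl ler_wpM2r//.
rewrite -natrX ler_nat -[n in (2 ^ n)%N]card_ord -cardsT -card_powerset.
by apply/subset_leq_card/fintype.subsetP => S _; rewrite inE finset.subsetT.
Qed.

(** * Subsampling parameters *)

Section Subsample.
Context {R : realType} (p s1 s2 : R).
Hypotheses (p01 : 0 <= p <= 1) (s101 : 0 <= s1 <= 1) (s201 : 0 <= s2 <= 1).
Local Notation P := (subsample p s1 s2).
Local Notation p11 := (P true true).

Lemma subsample_ge0 a b : 0 <= P a b.
Proof.
case/andP: p01 => p0 p1; case/andP: s101 => ? ?; case/andP: s201 => ? ?.
case: a; case: b => /=; rewrite ?mulr_ge0 ?subr_ge0//.
by rewrite (le_trans p1)// lerDr !mulr_ge0 ?subr_ge0.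
Qed.

Let mul_ge0 a b c d : 0 <= P a b * P c d.
Proof. by apply: mulr_ge0; exact: subsample_ge0. Qed.

Lemma subsample_sum1 : \sum_a \sum_b P a b = 1.
Proof. by rewrite !big_bool/=; ring. Qed.

Let both : s1 * s2 <= 1.
Proof. by case/andP: s101 => ? ?; case/andP: s201 => ? ?; rewrite mulr_ile1. Qed.

Lemma subsample11_le : p11 <= p.
Proof. by case/andP: p01 => ? ?; rewrite /= -mulrA ler_piMr. Qed.

Lemma subsample_le1 a b : P a b <= 1.
Proof.
have := subsample_sum1; rewrite !big_bool/=.
move: (subsample_ge0 true true) (subsample_ge0 true false).
move: (subsample_ge0 false true) (subsample_ge0 false false).
by case: a; case: b => /=; lra.
Qed.

Lemma subsample_le_sqrt : p <= Num.sqrt p.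
Proof.
case/andP: p01 => p0 p1; rewrite -[leLHS]ger0_norm// -sqrtr_sqr ler_wsqrtr//.
by rewrite expr2 ler_piMr.
Qed.

Lemma subsample_discord_le : P true false * P false true <= p * p11.
Proof.
case/andP: p01 => p0 p1; case/andP: s101 => s10 s11; case/andP: s201 => s20 s21.
rewrite /= (_ : _ * _ = (p * (p * s1 * s2)) * ((1 - s1) * (1 - s2))); last by ring.
by rewrite ler_piMr ?mulr_ge0// mulr_ile1 ?subr_ge0//; lra.
Qed.

Lemma sqrt_concord_discord_le :
  Num.sqrt (p11 * P false false) * Num.sqrt (P true false * P false true)
  <= p11 * Num.sqrt p.
Proof.
have p0 : 0 <= p by case/andP: p01.
have a0 := subsample_ge0 true true; have d0 := subsample_ge0 false false.
have b0 := subsample_ge0 true false; have c0 := subsample_ge0 false true.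
rewrite -sqrtrM; last exact: mulr_ge0.
rewrite -[X in X * Num.sqrt p]ger0_norm// -sqrtr_sqr -sqrtrM ?sqr_ge0//.
rewrite ler_wsqrtr// expr2 -2!mulrA ler_wpM2l// [leRHS]mulrC.
apply: le_trans subsample_discord_le.
by apply: ler_piMl; [exact: mul_ge0 | exact: subsample_le1].
Qed.

(** Expand the square: one [Num.sqrt p] comes from [P false false >= 1 - p], two come from the cross
    term. *)
Lemma affinity_gap_ge_sparse : p11 * (1 - 3 * Num.sqrt p) <= affinity_gap P.
Proof.
rewrite /affinity_gap sqrrB !sqr_sqrtr ?mul_ge0//.
have := sqrt_concord_discord_le; have := subsample_ge0 true true.
have : 0 <= P true false * P false true by exact: mul_ge0.
have : p11 * (1 - Num.sqrt p) <= p11 * P false false.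
  rewrite ler_wpM2l ?subsample_ge0//.
  have := subsample_le_sqrt.
  suff : 0 <= p * (1 - s1) * (1 - s2) by rewrite /=; lra.
  case/andP: p01 => p0 p1; case/andP: s101 => s10 s11; case/andP: s201 => s20 s21.
  by rewrite !mulr_ge0 ?subr_ge0.
lra.
Qed.

(** With [u] and [v] the two roots in the gap, [u ^+ 2 - v ^+ 2] is [p11 * (1 - p)], while [u + v]
    is at most twice the root of [p11]; the gap is the square of their quotient. *)
Lemma affinity_gap_ge : p11 * ((1 - p) ^+ 2 / 4) <= affinity_gap P.
Proof.
have P0 := subsample_ge0; case/andP: p01 => p0 p1.
have [a0|a0] := eqVneq p11 0; first by rewrite a0 mul0r affinity_gap_ge0.
have a_gt0 : 0 < p11 by rewrite lt_def a0 P0.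
have uE : Num.sqrt (p11 * P false false) ^+ 2 = p11 * P false false.
  by rewrite sqr_sqrtr ?mul_ge0.
have vE : Num.sqrt (P true false * P false true) ^+ 2 = P true false * P false true.
  by rewrite sqr_sqrtr ?mul_ge0.
have E : p11 * P false false - P true false * P false true = p11 * (1 - p).
  by rewrite /=; ring.
have d1 := subsample_le1 false false.
rewrite /affinity_gap; move: uE vE.
have : 0 <= Num.sqrt (p11 * P false false) by exact: sqrtr_ge0.
have : 0 <= Num.sqrt (P true false * P false true) by exact: sqrtr_ge0.
have : Num.sqrt (P true false * P false true) <= Num.sqrt (p11 * P false false).
  rewrite ler_wsqrtr// -subr_ge0 E.
  by apply: mulr_ge0; [exact: P0 | rewrite subr_ge0].
set u := Num.sqrt (p11 * _); set v := Num.sqrt (P true false * _).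
move=> vu v0 u0 uE vE.
have a4_gt0 : 0 < 4 * p11 by apply: mulr_gt0.
rewrite -(ler_pM2r a4_gt0).
rewrite (_ : _ * _ * _ = ((u - v) * (u + v)) ^+ 2); last first.
  by rewrite -subr_sqr uE vE E; field.
rewrite exprMn ler_wpM2l ?sqr_ge0//.
apply: (@le_trans _ _ (4 * u ^+ 2)).
  rewrite (_ : 4 * u ^+ 2 = (2 * u) ^+ 2); last by ring.
  by rewrite lerXn2r ?nnegrE ?addr_ge0 ?mulr_ge0//; lra.
rewrite uE ler_wpM2l//; apply: ler_piMr => //; exact: P0.
Qed.

(** With [y = x - 1], the terms of [norm_tilt] other than [1 - 2 * p11] sum to at most [2 * p11 *
    Num.sqrt p * (3 + 3 * y + y ^+ 2)], where the constant [3] is the loss in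
    [affinity_gap_ge_sparse]. *)
Lemma norm_tilt_le1 (x : R) : 1 <= x ->
  Num.sqrt p * (3 + 3 * (x - 1) + (x - 1) ^+ 2) <= 1 ->
  \sum_b \sum_c (\sum_a tilt P x a b * Num.sqrt (P a c)) ^+ 2 <= 1.
Proof.
move=> x1 small; rewrite norm_tilt ?subsample_sum1//; last exact: subsample_ge0.
have y0 : 0 <= x - 1 by rewrite subr_ge0.
move: small y0; set y := x - 1 => small y0.
have a0 := subsample_ge0 true true.
have pr := subsample_le_sqrt; have r0 : 0 <= Num.sqrt p by exact: sqrtr_ge0.
have ap := subsample11_le.
have acp : p11 + P false true <= p.
  rewrite /= (_ : _ + _ = p * s2); last by ring.
  by case/andP: p01 => ? ?; case/andP: s201 => ? ?; rewrite ler_piMr.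
have bp : P true false <= p.
  case/andP: p01 => p0 p1; case/andP: s101 => s10 s11; case/andP: s201 => s20 s21.
  by rewrite /= -mulrA ler_piMr// mulr_ile1//; lra.
have h1 : p11 * (p11 + P false true) <= p11 * Num.sqrt p.
  by rewrite ler_wpM2l// (le_trans acp).
have h2 : p11 ^+ 2 <= p11 * Num.sqrt p by rewrite expr2 ler_wpM2l// (le_trans ap).
have h3 : p11 * P true false <= p11 * Num.sqrt p by rewrite ler_wpM2l// (le_trans bp).
have h4 := sqrt_concord_discord_le.
have h5 := affinity_gap_ge_sparse.
have h6 : p11 * (Num.sqrt p * (3 + 3 * y + y ^+ 2)) <= p11 * 1 by rewrite ler_wpM2l.
have y2 : 0 <= y ^+ 2 by rewrite sqr_ge0.
have g1 := ler_wpM2l y0 h1; have g2 := ler_wpM2l y2 h2.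
have g3 := ler_wpM2l y0 h3; have g3' := ler_wpM2l y2 h3; have g4 := ler_wpM2l y0 h4.
move: g1 g2 g3 g3' g4 h5 h6.
set ab := p11 * P true false; set uv := Num.sqrt _ * Num.sqrt _.
set gap := affinity_gap _; set a := P true true; set c := P false true.
set r := Num.sqrt p.
by clearbody ab uv gap a c r y; clear; lra.
Qed.

End Subsample.

(** * Achievability *)

Section MAPBounds.
Context {R : realType} (n m : nat) (p s1 s2 q t1 t2 : R).
Hypotheses (p01 : 0 <= p <= 1) (s101 : 0 <= s1 <= 1) (s201 : 0 <= s2 <= 1).
Hypotheses (q01 : 0 <= q <= 1) (t101 : 0 <= t1 <= 1) (t201 : 0 <= t2 <= 1).
Hypothesis n6 : (6 <= n)%N.
Local Notation pp := (subsample p s1 s2).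
Local Notation qq := (subsample q t1 t2).
Local Notation PL := (pair_law (n := n) (m := m) pp qq).

Let pp0 := subsample_ge0 p01 s101 s201.
Let qq0 := subsample_ge0 q01 t101 t201.
Let pp1 := subsample_sum1 p s1 s2.
Let qq1 := subsample_sum1 q t1 t2.
Let N : R := n%:R.
Let M : R := m%:R.

Let N6 : 6 <= N. Proof. by rewrite ler_nat. Qed.

Let size_le (S : {set 'I_n}) : (#|S|)%:R <= N.
Proof. by rewrite ler_nat -[leqRHS]card_ord max_card. Qed.

Let exp_rate (rate : R) k :
  expR (- (k%:R * (ln N + rate))) = (expR (- rate) / N) ^+ k.
Proof.
have N_ge6 := N6; have N0 : 0 < N by lra.
by rewrite mulrC -mulNr expRM_natr opprD expRD [expR (- ln N)]expRN lnK ?posrE// mulrC.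
Qed.

(** Discounting one fixed pair per moved user turns the [1] in the count of touching pairs into
    [3]. *)
Let direct_le (rate : R) (S : {set 'I_n}) :
  (#|S|)%:R * (ln N + rate) <=
    affinity_gap pp * ((#|S|)%:R * (2 * N - (#|S|)%:R - 3) / 2)
    + affinity_gap qq * ((#|S|)%:R * M) ->
  \sum_(g : graph n m * graph n m | fooled_moving pp qq S g) PL g <=
  ((#|S|)`!)%:R * (expR (- rate) / N) ^+ #|S|.
Proof.
move=> le_gap; rewrite -exp_rate.
rewrite (eq_bigl (fun g => fooled_moving pp qq S g && true)); last first.
  by move=> g; rewrite andbT.
apply: (@sum_fooled_moving_le _ _ _ _ _ pp0 qq0 S xpredT); first exact: expR_ge0.
move=> s sS; rewrite (eq_bigl (fooled pp qq s)); last by move=> g; rewrite andbT.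

apply: le_trans (sum_fooled_le m pp0 qq0 pp1 qq1 s) _; rewrite ler_expR sS natrM.
have := card_touching_pairs_double R S; rewrite -/N -/M => T2.
have -> : (#|touching_pairs S|)%:R = (#|S|)%:R * (2 * N - (#|S|)%:R - 1) / 2 :> R.
  by rewrite -T2 mulfK.
move: le_gap; lra.
Qed.

Lemma MAP_error_dense (c : R) (est : estimator n m) :
  is_MAP pp qq est ->
  0 <= c -> c * pp true true <= affinity_gap pp -> c * qq true true <= affinity_gap qq ->
  2 * ln N <= c * (N * pp true true / 4 + M * qq true true) ->
  error_prob pp qq est <= 2 / N.
Proof.
move=> MAP c0 gap_pp gap_qq big.
have N_ge6 := N6; have N0 : 0 < N by lra.
apply: le_trans (MAP_error_le pp0 qq0 MAP) _.
have rE : expR (- ln N) = N^-1 by rewrite expRN lnK.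
have := @exists_fooled_le R n m pp qq (expR (- ln N)) 0 pp0 qq0.
rewrite mulr0 add0r rE; apply => //.
  by rewrite invr_ge0 ltW//= lef_pV2 ?posrE// (le_trans _ N6)//; lra.
move=> S S0; rewrite add0r -[X in X / _]rE; apply: direct_le.
have k0 : 0 <= (#|S|)%:R :> R by [].
have kN := size_le S.
move: k0 kN; set k := (#|S|)%:R => k0 kN.
have a0 := pp0 true true; have b0 := qq0 true true.
apply: le_trans (_ : k * (c * (N * pp true true / 4 + M * qq true true)) <= _).
  by rewrite ler_wpM2l//; lra.
apply: le_trans (_ : c * pp true true * (k * (N / 4)) + c * qq true true * (k * M) <= _).
  by rewrite le_eqVlt; apply/orP; left; apply/eqP; ring.
rewrite lerD// ?ler_wpM2r ?mulr_ge0//.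
apply: ler_pM => //.
- by apply: mulr_ge0.
- by rewrite mulr_ge0// divr_ge0// ltW.
(* [(2 * N - k - 3) / 2 >= N / 4] for all [k <= N] is exactly [N >= 6]. *)
- by rewrite -mulrA ler_wpM2l//; lra.
Qed.

(** The gaps are now [p_11] and [q_11] up to relative errors [3 * Num.sqrt p] and [3 * Num.sqrt q].
    Through [C] each becomes an additive loss of [3 * C] per moved user, hence [6 * C]. *)
Lemma MAP_error_sparse (C rate : R) (est : estimator n m) :
  is_MAP pp qq est ->
  0 <= C -> 1 <= rate ->
  Num.sqrt p * (3 + 3 * (expR 16 - 1) + (expR 16 - 1) ^+ 2) <= 1 ->
  (expR 16 - 1) * pp true true <= 1 ->
  Num.sqrt p * (N * pp true true) <= C -> Num.sqrt q * (M * qq true true) <= C ->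
  ln N + rate + 18 + 6 * C <= N * pp true true + M * qq true true ->
  error_prob pp qq est <= expR (- N) + 2 * expR (- rate).
Proof.
move=> MAP C0 rate1 small_p small_a pC qC big.
have N_ge6 := N6; have N0 : 0 < N by lra.
have lnN0 : 0 <= ln N by rewrite ln_ge0//; lra.
have e1 : 2 <= expR 1 :> R by have := expR_ge1Dx (1 : R); lra.
apply: le_trans (MAP_error_le pp0 qq0 MAP) _.
have r01 : 0 <= expR (- rate) <= 2^-1.
  rewrite expR_ge0/= (@le_trans _ _ (expR (-1)))//.
    by rewrite ler_expR lerN2.
  by rewrite expRN lef_pV2 ?posrE ?expR_gt0.
(* The factor [2 ^+ n] is at most [expR N], so half of the exponent survives. *)
apply: (@le_trans _ _ (2 ^+ n * expR (- (2 * N)) + 2 * expR (- rate))); last first.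
  rewrite lerD2r (_ : expR (- N) = expR 1 ^+ n * expR (- (2 * N))).
    by rewrite ler_wpM2r ?expR_ge0// lerXn2r ?nnegrE ?expR_ge0.
  by rewrite -expRM_natr mul1r -expRD; congr expR; rewrite /N; ring.
apply: exists_fooled_le => //.
move=> S S0.
have k0 : 0 <= (#|S|)%:R :> R by [].
have kN := size_le S.
have k1 : 1 <= (#|S|)%:R :> R by rewrite ler1n card_gt0.
have a0 := pp0 true true; have b0 := qq0 true true.
have M0 : 0 <= M by [].
have T2 := card_touching_pairs_double R S.
have gap_qq : (#|S|)%:R * (M * qq true true - 3 * C) <=
    affinity_gap qq * ((#|S|)%:R * M).
  rewrite [leRHS]mulrCA ler_wpM2l//.
  apply: le_trans (_ : qq true true * (1 - 3 * Num.sqrt q) * M <= _).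
    by move: qC; lra.
  by rewrite ler_wpM2r// affinity_gap_ge_sparse.
(* The affinity bound alone loses [k * pp true true / 2] per moved user, where
   [k = #|S|]. This is bounded in the first case; in the second one, the
   probability that [S] touches few common pairs is at most [expR (- (2 * N))],
   which survives the union bound over the [2 ^ n] sets [S]. *)
have [few|many] := ltP ((#|S|)%:R * pp true true) 32.
  rewrite -[leLHS]add0r lerD ?expR_ge0//; apply: direct_le.
  move: few gap_qq T2 k0 k1 kN; set k := (#|S|)%:R; move=> few gap_qq T2 k0 k1 kN.
  have r0 : 0 <= Num.sqrt p by exact: sqrtr_ge0.
  have r3 : 3 * Num.sqrt p <= 1.
    apply: le_trans small_p; rewrite mulrC ler_wpM2l//.
    have := sqr_ge0 (expR 16 - 1 : R).
    have : 0 <= expR 16 - 1 :> R by rewrite subr_ge0 -expR0 ler_expR.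
    lra.
  (* The constant 18 covers [k * pp true true / 2 < 16] and [3 * pp true true / 2 <= 3 / 2]. *)
  have gap_pp : k * (N * pp true true - 3 * C - 18) <=
      affinity_gap pp * (k * (2 * N - k - 3) / 2).
    apply: le_trans (_ : pp true true * (1 - 3 * Num.sqrt p) * (k * (2 * N - k - 3) / 2) <= _).
      rewrite (_ : _ * _ * _ = k * (pp true true *
        ((1 - 3 * Num.sqrt p) * ((2 * N - k - 3) / 2)))); last by ring.
      rewrite ler_wpM2l//.
      have h : (2 * N - k - 3) / 2 - 3 * Num.sqrt p * N <=
          (1 - 3 * Num.sqrt p) * ((2 * N - k - 3) / 2).
        have : 0 <= Num.sqrt p * (k + 3) by rewrite mulr_ge0// addr_ge0.
        lra.
      apply: le_trans (ler_wpM2l a0 h).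
      have a1 := subsample_le1 p01 s101 s201 true true.
      move: few pC a1; set a := pp true true; lra.
    rewrite ler_wpM2r ?affinity_gap_ge_sparse//.
    by rewrite divr_ge0// mulr_ge0//; lra.
  apply: le_trans (lerD gap_pp gap_qq).
  by rewrite -mulrDr ler_wpM2l//; lra.
(* The tilt [expR 16] gains exactly [k * N * p_11] at this level. The lower tail has exponent at
   most [- k * N * p_11 / 16], since at least [k * N / 4] pairs are touched, and [k * p_11 >= 32]
   makes this at most [- 2 * N]. *)
pose nu : R := (#|S|)%:R * N * pp true true / 16.
have tau1 : 1 <= expR 16 :> R by rewrite -expR0 ler_expR.
rewrite (bigID (fun g => (common_pairs S g)%:R < nu))/= lerD//.
  apply: le_trans (_ : \sum_(g : graph n m * graph n m | (common_pairs S g)%:R < nu) PL g <= _).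
    rewrite big_mkcond [leRHS]big_mkcond ler_sum//= => g _.
    by case: (fooled_moving _ _ _ _) => //=; case: ifP => // _; exact: pair_law_ge0.
  apply: le_trans (sum_few_common_le m pp0 qq0 pp1 qq1 S nu) _; rewrite ler_expR /nu.
  rewrite -/N in T2.
  have -> : (#|touching_pairs S|)%:R = (#|S|)%:R * (2 * N - (#|S|)%:R - 1) / 2 :> R.
    by rewrite -T2 mulfK.
  move: many kN k0; set k := (#|S|)%:R; set a := pp true true => many kN k0.
  have ka : 0 <= k * a by rewrite mulr_ge0.
  have : k * a * (N / 4) <= k * a * ((2 * N - k - 1) / 2) by rewrite ler_wpM2l//; lra.
  have : 32 * N <= k * a * N by rewrite ler_wpM2r// ltW.
  lra.
rewrite -exp_rate; apply: (sum_fooled_moving_le pp0 qq0).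
  exact: expR_ge0.
move=> s sS; apply: le_trans (_ : \sum_(g : graph n m * graph n m |
    fooled pp qq s g && (nu <= (common_pairs (moved s) g)%:R)) PL g <= _).
  rewrite le_eqVlt; apply/orP; left; apply/eqP/eq_bigl => g.
  by rewrite sS -leNgt.
have norm1 := norm_tilt_le1 p01 s101 s201 tau1 small_p.
apply: le_trans (sum_fooled_many_common_le m pp0 qq0 pp1 qq1 s nu _ norm1) _ => //.
rewrite ler_expR sS natrM -/M /nu.
have : (#|S|)%:R * ((expR 16 - 1) * pp true true) <= (#|S|)%:R * 1.
  by apply: ler_wpM2l.
have : (#|S|)%:R * (ln N + rate + 18 + 6 * C) <=
    (#|S|)%:R * (N * pp true true + M * qq true true) by rewrite ler_wpM2l.
have : 0 <= (#|S|)%:R * C by rewrite mulr_ge0.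
move: gap_qq; set k := (#|S|)%:R; set a := pp true true; set b := qq true true.
lra.
Qed.

End MAPBounds.

(** * Converse *)

Lemma touches1 n m (S : {set 'I_n}) (e : edge n m) :
  touches S e -> exists2 i, i \in S & touches [set i]%SET e.
Proof.
case: e => [e|[i a]] /=; last by exists i; rewrite // inE.
move=> /pred0Pn[i /= /andP[ie iS]]; exists i => //.
by apply/pred0Pn; exists i; rewrite /= ie inE eqxx.
Qed.

Lemma moved_edge_touches n m (s : 'S_n) (e : edge n m) :
  move_edge s e != e -> touches (moved s) e.
Proof.
apply: contraNT; case: e => [e|[i a]] /= untouched; apply/eqP.
  by congr inl; apply: move_pair_untouched; rewrite inE.
by congr (inr (_, _)); move: untouched; rewrite inE negbK => /eqP.
Qed.

Lemma touchesU n m (S T : {set 'I_n}) (e : edge n m) :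
  touches (S :|: T)%SET e = touches S e || touches T e.
Proof.
case: e => [e|[i a]] /=; last by rewrite inE.
by rewrite -!finset.setI_eq0 finset.setIUr finset.setU_eq0 negb_and.
Qed.

Section Converse.
Context {R : realType} (n m : nat) (pp qq : bool -> bool -> R).
Hypotheses (pp0 : forall a b, 0 <= pp a b) (qq0 : forall a b, 0 <= qq a b).
Hypotheses (pp1 : \sum_a \sum_b pp a b = 1) (qq1 : \sum_a \sum_b qq a b = 1).
Hypothesis pp_cov : pp true false * pp false true <= pp true true * pp false false.
Hypothesis qq_cov : qq true false * qq false true <= qq true true * qq false false.
Local Notation PL := (pair_law (n := n) (m := m) pp qq).

Definition isolated (S : {set 'I_n}) (g : graph n m * graph n m) : bool :=
  [forall e, ~~ (touches S e && (g.1 e && g.2 e))].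

Lemma isolatedU S T g : isolated (S :|: T)%SET g = isolated S g && isolated T g.
Proof.
apply/forallP/andP => [ST|[/forallP iS /forallP iT] e].
  by split; apply/forallP => e; have := ST e; rewrite touchesU;
     apply: contra => /andP[-> ->]; rewrite ?orbT.
by rewrite touchesU andb_orl negb_or iS iT.
Qed.

Lemma sum_isolated S :
  \sum_g PL g * (isolated S g)%:R =
  (1 - pp true true) ^+ #|touching_pairs S| * (1 - qq true true) ^+ (#|S| * m).
Proof.
rewrite -prod_touching.
pose F (e : edge n m) a b : R := edge_law pp qq e a b *
  (if touches S e && (a && b) then 0 else 1).
transitivity (\sum_(g : graph n m * graph n m) \prod_e F e (g.1 e) (g.2 e)).
  apply: eq_bigr => g _; rewrite /F big_split/=; congr (_ * _).
  have [/forallP iso|/forallPn[e]] := boolP (isolated S g).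
    by rewrite big1// => e _; rewrite (negbTE (iso e)).
  by rewrite negbK => common; rewrite (bigD1 e)//= common mul0r.
rewrite (sum_pair_prod F); apply: eq_bigr => e _; rewrite /F.
have lawE : \sum_a \sum_b edge_law pp qq e a b = 1 by case: e.
move: lawE; rewrite !big_bool/= !andbT !andbF /= => lawE.
by case: ifP => _; case: e lawE => [e|[i a]] /=; lra.
Qed.

(** In the squared likelihoods each edge is matched with its image under the swap. If the edge is
    moved, neither of the two is common to both graphs, so the only changes replace [p_10 * p_01] by
    [p_11 * p_00], or the same for [q]. *)
Lemma pair_law_swap_le (i j : 'I_n) g :
  isolated [set i; j]%SET g -> PL g <= PL (g.1, relabel (tperm i j) g.2).
Proof.
move=> /forallP iso; pose t := @move_edge n m (tperm i j).
have tK : involutive t by move=> e; rewrite /t -move_edgeM tperm2 move_edge1.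
have W0 e a b := edge_law_ge0 (n := n) (m := m) pp0 qq0 e a b.
have WK e : edge_law pp qq (t e) = edge_law pp qq e by exact: edge_law_move.
rewrite -ler_sqr ?nnegrE ?pair_law_ge0// !expr2 /pair_law/=.
rewrite [X in X * _ <= _](reindex_inj (inv_inj tK))/=.
rewrite [X in _ <= X * _](reindex_inj (inv_inj tK))/= -!big_split/=.
apply: ler_prod => e _; rewrite !WK mulr_ge0//=.
rewrite !ffunE tpermV -/(t _) -/(t _) tK.
have [->//|te] := eqVneq (t e) e.
have touch f : t f != f -> ~~ (g.1 f && g.2 f).
  move=> tf; have := iso f; rewrite negb_and => /orP[|//].
  have [k kij kf] := touches1 (moved_edge_touches tf).
  have {}kij : k \in [set i; j]%SET.
    move: kij; rewrite !inE; apply: contraR; rewrite negb_or => /andP[ki kj].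
    by rewrite tpermD// eq_sym.
  suff -> : touches [set i; j]%SET f by [].
  have -> : [set i; j]%SET = ([set k] :|: [set i; j])%SET.
    by apply/esym/finset.setUidPr; rewrite finset.sub1set.
  by rewrite touchesU kf.
have tte : t (t e) != t e by rewrite (inj_eq (inv_inj tK)).
move: (touch _ te) (touch _ tte).
have cov : edge_law pp qq e true false * edge_law pp qq e false true <=
           edge_law pp qq e true true * edge_law pp qq e false false.
  by case: (e) => /=.
case: (g.1 e); case: (g.2 e); case: (g.1 (t e)); case: (g.2 (t e)) => //= _ _.
all: by [| rewrite mulrC | rewrite mulrC [leRHS]mulrC].
Qed.

Definition num_isolated (g : graph n m * graph n m) : nat :=
  #|[set i | isolated [set i]%SET g]%SET|.

(* Swapping two isolated users in both [G2] and [Pistar] keeps the observation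
   [(G1, G2')] and does not decrease the probability; on the outcomes which the
   estimator gets right, the observation determines the outcome, so that the
   swap is injective there, and it makes the estimator wrong. *)
Lemma many_isolated_le_error (est : estimator n m) :
  \sum_(g | (1 < num_isolated g)%N) PL g <= 2 * error_prob pp qq est.
Proof.
pose many (w : outcome n m) := (1 < num_isolated w.1)%N.
pose wrong (w : outcome n m) := est (G1 w) (G2' w) != Pistar w.
have law0 w : 0 <= law pp qq w by exact: law_ge0.
have -> : \sum_(g | (1 < num_isolated g)%N) PL g = \sum_(w | many w) law pp qq w.
  rewrite big_mkcond [RHS]big_mkcond/=.
  rewrite (eq_bigr (fun g => PL g * ((1 < num_isolated g)%N)%:R)); last first.
    by move=> g _; case: ifP => _; rewrite (mulr1, mulr0).
  rewrite -sum_law; apply: eq_bigr => w _; rewrite /many.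
  by case: ifP => _; rewrite (mulr1, mulr0).
(* Wrong outcomes are bounded directly and right ones through their swaps, hence the factor 2. *)
rewrite (bigID wrong)/= mulr_natl mulr2n lerD//.
  rewrite /error_prob /Pr big_mkcond [leRHS]big_mkcond ler_sum//= => w _.
  by case: (many w) => //=; case: ifP.
pose swap (w : outcome n m) : outcome n m :=
  if [pick ij : 'I_n * 'I_n | (ij.1 != ij.2) &&
        isolated [set ij.1; ij.2]%SET w.1] is Some ij
  then let t := tperm ij.1 ij.2 in
       (G1 w, relabel t (G2 w), (t * Pistar w)%g)
  else w.
have swapP w : many w ->
    [/\ law pp qq w <= law pp qq (swap w), G1 (swap w) = G1 w,
        G2' (swap w) = G2' w & Pistar (swap w) != Pistar w].
  rewrite /many /num_isolated => /card_gt1P[i [j [iI jI ij]]]; rewrite /swap.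
  case: pickP => [[k l] /= /andP[kl iso]|/(_ (i, j))/=]; last first.
    move: iI jI; rewrite !inE => iI jI.
    by rewrite ij isolatedU iI jI.
  split=> //.
  - rewrite /law ler_wpM2r ?invr_ge0// /G1 /G2/=.
    by have := pair_law_swap_le iso; rewrite -surjective_pairing.
  - rewrite /G2' /Pistar /G2/= -relabelM mulgA tperm2 mul1g//.
  - rewrite /Pistar/= -[X in _ != X]mul1g (inj_eq (mulIg _)).
    apply/eqP => /permP/(_ k); rewrite tpermL perm1 => lk.
    by rewrite lk eqxx in kl.
apply: le_trans (_ : \sum_(w | many w && ~~ wrong w) law pp qq (swap w) <= _).
  by apply: ler_sum => w /andP[/swapP[]].
have swap_inj : {in [set w | many w && ~~ wrong w]%SET &, injective swap}.
  move=> w w'; rewrite !inE !negbK => /andP[/swapP[_ g1 g2 _] /eqP est_w].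
  move=> /andP[/swapP[_ g1' g2' _] /eqP est_w'] eq_swap.
  have obs1 : G1 w = G1 w' by rewrite -g1 -g1' eq_swap.
  have obs2 : G2' w = G2' w' by rewrite -g2 -g2' eq_swap.
  have obs3 : Pistar w = Pistar w' by rewrite -est_w -est_w' obs1 obs2.
  have obs4 : G2 w = G2 w'.
    move: obs2; rewrite /G2' obs3 => /(congr1 (relabel (Pistar w')^-1%g)).
    by rewrite -!relabelM mulgV !relabel1.
  case: w w' obs1 obs3 obs4 {est_w est_w' g1 g2 g1' g2' eq_swap obs2}.
  by move=> [[a b] s] [[a' b'] s']; rewrite /G1 /G2 /Pistar/= => -> -> ->.
rewrite -big_set/= -(big_imset _ swap_inj)/= /error_prob /Pr.
rewrite big_mkcond [leRHS]big_mkcond ler_sum//= => w _.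
case: ifP => [/imsetP[v]|_]; last by case: ifP.
rewrite !inE negbK => /andP[/swapP[_ g1 g2 ps] /eqP est_v] ->.
by rewrite g1 g2 est_v eq_sym ps.
Qed.

Lemma touching_pairs1 (i : 'I_n) : #|touching_pairs [set i]%SET| = n.-1.
Proof.
have := card_touching_pairs [set i]%SET; rewrite cards1.
case: n i => [[]//|k] i; rewrite subSS subn0 /= binS bin1 addnC => /addnI //.
Qed.

Lemma sum_num_isolated :
  \sum_g PL g * (num_isolated g)%:R =
  n%:R * ((1 - pp true true) ^+ n.-1 * (1 - qq true true) ^+ m).
Proof.
transitivity (\sum_(i < n) \sum_g PL g * (isolated [set i]%SET g)%:R).
  rewrite exchange_big/=; apply: eq_bigr => g _.
  rewrite -mulr_sumr -natr_sum; congr (_ * _%:R).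
  by rewrite /num_isolated -sum1_card big_mkcond/=; apply: eq_bigr => i _; rewrite inE; case: ifP.
rewrite (eq_bigr (fun _ => (1 - pp true true) ^+ n.-1 * (1 - qq true true) ^+ m)).
  by rewrite sumr_const card_ord mulr_natl.
by move=> i _; rewrite sum_isolated touching_pairs1 cards1 mul1n.
Qed.

(** The successor makes up for the pair of [i] and [j], which both stars contain. *)
Lemma touching_pairs2 (i j : 'I_n) : i != j ->
  (#|touching_pairs [set i; j]%SET|.+1 = n.-1 + n.-1)%N.
Proof.
move=> ij; have := card_touching_pairs [set i; j]%SET; rewrite cards2 ij.
case: n i j ij => [[]//|[|k]] i j ij; first by rewrite !ord1 in ij.
rewrite !subSS subn0 /= !binS !bin1 !bin0 => E.
by apply/eqP; rewrite -(eqn_add2r 'C(k, 2)) addSn E; apply/eqP; ring.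
Qed.

(** Two users are nearly independent: the pair joining them is counted once instead of twice, and
    the factor [1 - pp true true] restores the product. The diagonal gives [nu]. *)
Lemma sum_num_isolated_sq :
  (1 - pp true true) * \sum_g PL g * (num_isolated g)%:R ^+ 2 <=
  let nu := n%:R * ((1 - pp true true) ^+ n.-1 * (1 - qq true true) ^+ m) in
  nu + nu ^+ 2.
Proof.
set al := (1 - pp true true) ^+ n.-1 * (1 - qq true true) ^+ m.
have a1 : pp true true <= 1.
  move: pp1; rewrite !big_bool/= => E.
  by move: (pp0 true false) (pp0 false true) (pp0 false false); lra.
have b1 : qq true true <= 1.
  move: qq1; rewrite !big_bool/= => E.
  by move: (qq0 true false) (qq0 false true) (qq0 false false); lra.
have al0 : 0 <= al by rewrite mulr_ge0// exprn_ge0// subr_ge0.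
have -> : \sum_g PL g * (num_isolated g)%:R ^+ 2 =
    \sum_(i < n) \sum_(j < n) \sum_g PL g * (isolated [set i; j]%SET g)%:R.
  under [RHS]eq_bigr => i _ do rewrite exchange_big.
  rewrite exchange_big/=; apply: eq_bigr => g _.
  have -> : (num_isolated g)%:R = \sum_(i < n) (isolated [set i]%SET g)%:R :> R.
    rewrite -natr_sum /num_isolated -sum1_card big_mkcond/=.
    by congr (_%:R); apply: eq_bigr => i _; rewrite inE; case: ifP.
  rewrite expr2 big_distrlr/= mulr_sumr; apply: eq_bigr => i _.
  rewrite mulr_sumr; apply: eq_bigr => j _.
  by rewrite isolatedU -natrM mulnb.
rewrite mulr_sumr /= [leRHS](_ : _ = \sum_(i < n) (al + \sum_(j < n) al ^+ 2)); last first.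
  have sum_const c : \sum_(i < n) c = n%:R * c :> R.
    by rewrite sumr_const card_ord mulr_natl.
  by rewrite big_split/= !sum_const; ring.
apply: ler_sum => i _; rewrite mulr_sumr (bigD1 i)//= lerD//.
  rewrite finset.setUid sum_isolated touching_pairs1 cards1 mul1n -/al.
  by rewrite ler_piMl// gerBl.
rewrite [leRHS](bigD1 i)//= ler_wpDl ?sqr_ge0// ler_sum// => j ji.
rewrite eq_sym in ji.
rewrite sum_isolated cards2 ji mulrA -exprS touching_pairs2// /al.
by rewrite exprD mul2n -addnn exprD expr2 mulrACA.
Qed.

(** By the second moment, at most one isolated user remains with probability at most [1 / 2]; the
    swap argument halves the complementary probability. *)
Lemma error_ge_quarter (est : estimator n m) :
  pp true true <= 16^-1 ->
  16 <= n%:R * ((1 - pp true true) ^+ n.-1 * (1 - qq true true) ^+ m) ->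
  4^-1 <= error_prob pp qq est.
Proof.
move=> a_small; have := sum_num_isolated_sq; have := sum_num_isolated.
set nu := n%:R * _ => /= mean second nu16.
have total : \sum_g PL g = 1.
  rewrite (sum_pair_prod (fun (e : edge n m) a b => edge_law pp qq e a b)).
  by rewrite big1// => -[].
(* With at most one isolated user, the count is at least [nu - 1] below its mean. *)
have chebyshev : (\sum_(g | ~~ (1 < num_isolated g)%N) PL g) * (nu - 1) ^+ 2 <=
    \sum_g PL g * (num_isolated g)%:R ^+ 2 - nu ^+ 2.
  have -> : \sum_g PL g * (num_isolated g)%:R ^+ 2 - nu ^+ 2 =
      \sum_g PL g * ((num_isolated g)%:R - nu) ^+ 2.
    transitivity (\sum_g PL g * (num_isolated g)%:R ^+ 2
        - 2 * nu * (\sum_g PL g * (num_isolated g)%:R) + nu ^+ 2 * \sum_g PL g).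
      by rewrite mean total; ring.
    rewrite !mulr_sumr -sumrB -big_split/=; apply: eq_bigr => g _; ring.
  rewrite mulr_suml big_mkcond ler_sum//= => g _.
  case: ifP => few; last by rewrite mulr_ge0 ?sqr_ge0 ?pair_law_ge0.
  rewrite ler_wpM2l ?pair_law_ge0//.
  have X1 : (num_isolated g)%:R <= 1 :> R by rewrite (ler_nat _ _ 1%N) leqNgt.
  rewrite -[leRHS]sqrrN opprB lerXn2r ?nnegrE//; lra.
have := many_isolated_le_error est.
move: total; rewrite (bigID (fun g => (1 < num_isolated g)%N))/=.
move: chebyshev second.
set few := \sum_(g | ~~ _) _; set sq := \sum_g _ * _ ^+ 2.
move=> chebyshev second total err.
suff : few <= 2^-1 by lra.
have sq0 : 0 <= sq by apply: sumr_ge0 => g _; rewrite mulr_ge0 ?pair_law_ge0 ?sqr_ge0.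
have h : (1 - 16^-1) * sq <= nu + nu ^+ 2.
  apply: le_trans second; rewrite ler_wpM2r//; lra.
have few0 : 0 <= few by apply: sumr_ge0 => g _; exact: pair_law_ge0.
have nu2 : 16 * nu <= nu ^+ 2 by rewrite expr2 ler_wpM2r//; lra.
have nu1 : 0 < (nu - 1) ^+ 2 by rewrite exprn_gt0//; lra.
rewrite -(ler_pM2r nu1) (le_trans chebyshev)//.
move: h nu2; rewrite (_ : (nu - 1) ^+ 2 = nu ^+ 2 - 2 * nu + 1); last by ring.
lra.
Qed.

End Converse.

(** * Asymptotics *)

Lemma ln_sq_le (R : realType) (x : R) : 1 <= x -> ln x ^+ 2 <= 4 * x.
Proof.
move=> x1; have x0 : 0 < x by rewrite (lt_le_trans _ x1).
have r0 : 0 < Num.sqrt x by rewrite sqrtr_gt0.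
have lnx : ln x = 2 * ln (Num.sqrt x).
  by rewrite -{1}(sqr_sqrtr (ltW x0)) lnXn// mulr_natl.
have ln_le : ln (Num.sqrt x) <= Num.sqrt x.
  by rewrite -{2}[Num.sqrt x]lnK ?posrE// (le_trans _ (expR_ge1Dx _))// lerDr.
rewrite lnx exprMn (_ : 2 ^+ 2 = 4 :> R); last by ring.
rewrite ler_wpM2l// -[leRHS](sqr_sqrtr (ltW x0)) lerXn2r ?nnegrE ?(ltW r0)//.
by rewrite ln_ge0// -sqrtr1 ler_wsqrtr.
Qed.

(** Follows from [expR y >= 1 + y] and [(1 - x) * (1 + x + 2 * x ^+ 2) = 1 + x ^+ 2 * (1 - 2 *
    x)]. *)
Lemma expR_le_onem (R : realType) (x : R) :
  0 <= x <= 2^-1 -> expR (- (x + 2 * x ^+ 2)) <= 1 - x.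
Proof.
move=> /andP[x0 x2]; have y0 : 0 < 1 - x by lra.
rewrite expRN -[leRHS]invrK lef_pV2 ?posrE ?expR_gt0 ?invr_gt0//.
apply: le_trans (expR_ge1Dx _).
rewrite -(ler_pM2r y0) mulVf ?gt_eqF//.
have : 0 <= x ^+ 2 * (1 - 2 * x) by rewrite mulr_ge0 ?sqr_ge0//; lra.
rewrite -subr_ge0 (_ : _ * _ - 1 = x ^+ 2 * (1 - 2 * x)) //; ring.
Qed.

(** The thresholds are uniform in all parameters because the dense and the sparse regime may
    alternate along a sequence; the split is made for each [n] separately. *)
Lemma MAP_error_le_eventually (R : realType) (cu ca c1 K : R) :
  0 < cu -> 0 < ca -> 0 < c1 -> 1 <= K ->
  exists L0 K0 : R, forall n m (p s1 s2 q t1 t2 : R) (est : estimator n m),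
  0 <= p <= 1 -> 0 <= s1 <= 1 -> 0 <= s2 <= 1 ->
  0 <= q <= 1 -> 0 <= t1 <= 1 -> 0 <= t2 <= 1 ->
  (6 <= n)%N -> L0 <= ln n%:R -> c1 <= 1 - p -> c1 <= 1 - q ->
  cu * ln n%:R ^+ 4 <= s1 * s2 * n%:R -> ca * ln n%:R ^+ 3 <= t1 * t2 * m%:R ->
  K0 <= n%:R * subsample p s1 s2 true true + m%:R * subsample q t1 t2 true true
        - ln n%:R ->
  is_MAP (subsample p s1 s2) (subsample q t1 t2) est ->
  error_prob (subsample p s1 s2) (subsample q t1 t2) est <=
  2 / n%:R + expR (- n%:R) + 2 * expR (- K).
Proof.
move=> cu0 ca0 c10 K1.
(* [c] is the constant of [affinity_gap_ge] when [1 - p >= c1]. The value [c * B = 8] gives the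
   [2 * ln N] of the dense bound after its division by 4. *)
pose c := c1 ^+ 2 / 4; pose B := 8 / c.
pose Y : R := 3 + 3 * (expR 16 - 1) + (expR 16 - 1) ^+ 2.
pose C := Num.sqrt (B ^+ 3 / cu) + Num.sqrt (B ^+ 3 / ca).
have c0 : 0 < c by rewrite divr_gt0// exprn_gt0.
have B0 : 0 < B by rewrite divr_gt0.
have y0 : 0 <= expR 16 - 1 :> R by rewrite subr_ge0 -expR0 ler_expR.
have Y0 : 0 < Y by have := sqr_ge0 (expR 16 - 1 : R); rewrite /Y; lra.
have C0 : 0 <= C by rewrite addr_ge0 ?sqrtr_ge0.
exists (Num.max 1 (B / cu * Y ^+ 2)), (K + 18 + 6 * C).
move=> n m p s1 s2 q t1 t2 est p01 s101 s201 q01 t101 t201 n6.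
rewrite ge_max => /andP[L1 LY] p1 q1 s_large t_large excess MAP.
set N : R := n%:R in L1 LY s_large excess *; set M : R := m%:R in t_large excess.
set L := ln N in L1 LY s_large t_large excess.
have N6 : 6 <= N by rewrite ler_nat.
have M0 : 0 <= M by [].
have a0 := subsample_ge0 p01 s101 s201 true true.
have b0 := subsample_ge0 q01 t101 t201 true true.
have /andP[p0 p_le1] := p01; have /andP[q0 q_le1] := q01.
have gap_ge x u v : 0 <= x <= 1 -> 0 <= u <= 1 -> 0 <= v <= 1 -> c1 <= 1 - x ->
    c * subsample x u v true true <= affinity_gap (subsample x u v).
  move=> x01 u01 v01 x1; apply: le_trans (affinity_gap_ge x01 u01 v01).
  rewrite mulrC ler_wpM2l ?subsample_ge0// ler_wpM2r//.
  by rewrite lerXn2r ?nnegrE// ?(ltW c10)// (le_trans (ltW c10)).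
have e0 := expR_ge0 (- N); have eK := expR_ge0 (- K).
have N2 : 0 <= 2 / N by rewrite divr_ge0//; lra.
have [dense|sparse] := boolP ((B * L <= N * subsample p s1 s2 true true) ||
                              (B * L <= M * subsample q t1 t2 true true)).
  apply: le_trans (MAP_error_dense _ _ _ _ _ _ n6 MAP (ltW c0) _ _ _) _ => //;
    do ?exact: gap_ge.
  - have cB : c * B = 8 by rewrite /B mulrC divfK// gt_eqF.
    have u0 : 0 <= c * (N * subsample p s1 s2 true true).
      by apply: mulr_ge0; [exact: ltW | apply: mulr_ge0].
    have v0 : 0 <= c * (M * subsample q t1 t2 true true).
      by apply: mulr_ge0; [exact: ltW | apply: mulr_ge0].
    have cBL : c * (B * L) = 8 * L by rewrite mulrA cB.
    rewrite -/N -/M -/L.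
    case/orP: dense => /(ler_wpM2l (ltW c0)); rewrite cBL; lra.
  - by rewrite -/N; lra.
move: sparse; rewrite negb_or -!ltNge => /andP[sparse_p sparse_q].
have L0 : 0 < L by lra.
(* Here the powers of the logarithm are spent: [N * p_11 < B * L] and [s1 * s2 * N >= cu * L ^+ 4]
   leave [p] of order [L ^- 3]; likewise [q] is of order [L ^- 2]. *)
have pL : p * L ^+ 3 <= B / cu.
  rewrite ler_pdivlMr// -(ler_pM2r L0).
  apply: le_trans (ltW sparse_p).
  rewrite (_ : _ * _ * _ = p * (cu * L ^+ 4)); last by ring.
  rewrite (_ : N * _ = p * (s1 * s2 * N)); last by rewrite /=; ring.
  by rewrite ler_wpM2l.
have qL : q * L ^+ 2 <= B / ca.
  rewrite ler_pdivlMr// -(ler_pM2r L0).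
  apply: le_trans (ltW sparse_q).
  rewrite (_ : _ * _ * _ = q * (ca * L ^+ 3)); last by ring.
  rewrite (_ : M * _ = q * (t1 * t2 * M)); last by rewrite /=; ring.
  by rewrite ler_wpM2l.
have L23 : L ^+ 2 <= L ^+ 3 by rewrite ler_weXn2l.
have LL3 : L <= L ^+ 3 by rewrite -[leLHS]expr1 ler_weXn2l.
have pL2 : p * L ^+ 2 <= B / cu by apply: le_trans pL; rewrite ler_wpM2l.
(* A root of order [1 / L] times an expected degree below [B * L] is bounded by a constant. *)
have sqrt_le x z d : 0 <= x -> 0 <= z -> 0 < d ->
    x * L ^+ 2 <= B / d -> z < B * L -> Num.sqrt x * z <= Num.sqrt (B ^+ 3 / d).
  move=> x0 z0 d0 xL zB; rewrite -[z]ger0_norm// -sqrtr_sqr -sqrtrM//.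
  apply: ler_wsqrtr; apply: le_trans (_ : x * (B * L) ^+ 2 <= _).
    by rewrite ler_wpM2l// lerXn2r ?nnegrE ?(ltW zB)// mulr_ge0 ?(ltW B0) ?(ltW L0).
  rewrite [leLHS](_ : _ = B ^+ 2 * (x * L ^+ 2)); last first.
    by rewrite exprMn; clearbody B L; ring.
  rewrite (_ : B ^+ 3 / d = B ^+ 2 * (B / d)); last by rewrite mulrA -exprSr.
  by rewrite ler_wpM2l ?sqr_ge0.
have small_p : Num.sqrt p * Y <= 1.
  rewrite -[Y]ger0_norm ?(ltW Y0)// -sqrtr_sqr -sqrtrM// -[leRHS]sqrtr1.
  apply: ler_wsqrtr; rewrite -(ler_pM2r L0) mul1r; apply: le_trans LY.
  rewrite mulrAC ler_wpM2r ?sqr_ge0//; apply: le_trans pL.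
  by rewrite ler_wpM2l.
have r0 := sqrtr_ge0 p.
apply: le_trans (MAP_error_sparse p01 s101 s201 q01 t101 t201 n6 MAP C0 K1 small_p _ _ _ _) _.
- apply: le_trans small_p; rewrite mulrC; apply: ler_pM => //.
    exact: le_trans (subsample11_le p01 s101 s201) (subsample_le_sqrt p01).
  by have := sqr_ge0 (expR 16 - 1 : R); rewrite /Y; lra.
- apply: le_trans (sqrt_le _ _ _ _ _ cu0 pL2 sparse_p) _ => //.
    by rewrite mulr_ge0//; lra.
  by rewrite /C lerDl sqrtr_ge0.
- apply: le_trans (sqrt_le _ _ _ _ _ ca0 qL sparse_q) _ => //.
    by rewrite mulr_ge0.
  by rewrite /C lerDr sqrtr_ge0.
- by move: excess; rewrite -/N -/M -/L; lra.
- by rewrite -/N; lra.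
Qed.

(** The mean number of isolated users is about the exponential of minus the excess. Sparsity keeps
    the second-order terms [N * a ^+ 2] and [M * b ^+ 2] bounded. *)
Lemma error_ge_quarter_eventually (R : realType) (ca : R) : 0 < ca ->
  exists L0 : R, forall n m (p s1 s2 q t1 t2 : R) (est : estimator n m),
  0 <= p <= 1 -> 0 <= s1 <= 1 -> 0 <= s2 <= 1 ->
  0 <= q <= 1 -> 0 <= t1 <= 1 -> 0 <= t2 <= 1 ->
  (1024 <= n)%N -> L0 <= ln n%:R -> (0 < m)%N ->
  ca * ln n%:R ^+ 3 <= t1 * t2 * m%:R ->
  n%:R * subsample p s1 s2 true true + m%:R * subsample q t1 t2 true true
    - ln n%:R <= - 25 ->
  4^-1 <= error_prob (subsample p s1 s2) (subsample q t1 t2) est.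
Proof.
move=> ca0; exists (Num.max 1 (2 / ca)).
move=> n m p s1 s2 q t1 t2 est p01 s101 s201 q01 t101 t201 n_large.
rewrite ge_max => /andP[L1 Lca] m0 t_large excess.
have a0 := subsample_ge0 p01 s101 s201 true true.
have b0 := subsample_ge0 q01 t101 t201 true true.
have cov x u v : 0 <= x <= 1 -> 0 <= u <= 1 -> 0 <= v <= 1 ->
    subsample x u v true false * subsample x u v false true <=
    subsample x u v true true * subsample x u v false false.
  move=> /andP[x0 x1] /andP[u0 u1] /andP[v0 v1]; rewrite -subr_ge0.
  rewrite (_ : _ - _ = x * u * v * (1 - x)); last by rewrite /=; ring.
  by rewrite !mulr_ge0 ?subr_ge0.
set N : R := n%:R in L1 Lca t_large excess; set M : R := m%:R in t_large excess.
set L := ln N in L1 Lca t_large excess.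
have N_large : 1024 <= N by rewrite ler_nat.
have M0 : 0 < M by rewrite ltr0n.
set a := subsample p s1 s2 true true in a0 excess.
set b := subsample q t1 t2 true true in b0 excess.
have N0 : 0 < N by lra.
have Na0 : 0 <= N * a by rewrite mulr_ge0// ltW.
have Mb0 : 0 <= M * b by rewrite mulr_ge0// ltW.
have Na : N * a <= L by lra.
have Mb : M * b <= L by lra.
have lnN := ln_sq_le (_ : 1 <= N); rewrite -/L in lnN.
have {}lnN : L ^+ 2 <= 4 * N by apply: lnN; lra.
have Na2 : N * a ^+ 2 <= 4.
  rewrite -(ler_pM2r N0) (_ : _ * _ * _ = (N * a) ^+ 2); last by ring.
  by apply: le_trans lnN; rewrite lerXn2r ?nnegrE//; lra.
(* [N * a ^+ 2 <= 4] and [N >= 1024 = 4 * 16 ^ 2]. *)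
have a_small : a <= 16^-1.
  have : a ^+ 2 <= (16^-1) ^+ 2.
    rewrite -(ler_pM2l N0); apply: le_trans Na2 _.
    rewrite (_ : (16^-1) ^+ 2 = 256^-1 :> R); last by field.
    lra.
  by rewrite ler_sqr ?nnegrE//.
have tt : t1 * t2 <= 1.
  by case/andP: t101 => ? ?; case/andP: t201 => ? ?; rewrite mulr_ile1.
have LM : ca * L ^+ 3 <= M.
  by apply: le_trans t_large _; rewrite ler_piMl// ltW.
have caL : 2 <= ca * L by move: Lca; rewrite ler_pdivrMr// mulrC.
have L2 : L <= L ^+ 2 by rewrite -[leLHS]expr1 ler_weXn2l.
have L2M : 2 * L ^+ 2 <= M.
  apply: le_trans LM; rewrite (_ : ca * L ^+ 3 = ca * L * L ^+ 2); last by ring.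
  by rewrite ler_wpM2r ?sqr_ge0.
have b_small : b <= 2^-1.
  rewrite -(ler_pM2l M0); lra.
have Mb2 : M * b ^+ 2 <= 1.
  rewrite -(ler_pM2r M0) (_ : _ * _ * _ = (M * b) ^+ 2); last by ring.
  apply: (@le_trans _ _ (L ^+ 2)); first by rewrite lerXn2r ?nnegrE//; lra.
  by have := sqr_ge0 L; lra.
apply: (error_ge_quarter (subsample_ge0 p01 s101 s201) (subsample_ge0 q01 t101 t201)
  (subsample_sum1 p s1 s2) (subsample_sum1 q t1 t2)) => //; do ?exact: cov.
rewrite -/a -/b -/N.
(* The exponent is at least [25 - 2 * 4 - 2 * 1 = 15], and [expR 15 >= 1 + 15]. *)
apply: (@le_trans _ _ (expR (L - N * (a + 2 * a ^+ 2) - M * (b + 2 * b ^+ 2)))).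
  by apply: le_trans (expR_ge1Dx _); lra.
rewrite !expRD lnK ?posrE// -mulrA ler_wpM2l ?(ltW N0)//.
have onem_pow k x : 0 <= x <= 2^-1 ->
    expR (- (k%:R * (x + 2 * x ^+ 2))) <= (1 - x) ^+ k.
  move=> x01; rewrite mulrC -mulNr expRM_natr lerXn2r ?nnegrE ?expR_ge0//.
    by case/andP: x01; lra.
  exact: expR_le_onem.
apply: ler_pM; rewrite ?expR_ge0//; last by apply: onem_pow; rewrite b0.
apply: (@le_trans _ _ ((1 - a) ^+ n)).
  by apply: onem_pow; rewrite a0/=; lra.
by apply: ler_wiXn2l; [lra | lra | exact: leq_pred].
Qed.

(** * From limits inferior to eventual inequalities *)

Lemma limn_einfE (R : realType) (u : nat -> \bar R) :
  limn_einf u = ereal_sup (range (einfs u)).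
Proof. by rewrite limn_einf_lim; apply/cvg_lim => //; exact: cvg_einfs_sup. Qed.

Lemma liminfOmega_near (R : realType) (f g : nat -> R) :
  liminfOmega f g -> exists2 c : R, 0 < c & \forall n \near \oo, c <= `|f n| / g n.
Proof.
rewrite /liminfOmega limn_einfE.
move=> /ereal_sup_gt[_ [k _ <-]]; rewrite /einfs/=.
set e := ereal_inf _ => e0.
have lb n : (k <= n)%N -> (e <= (`|f n| / g n)%:E)%E.
  by move=> kn; apply: ereal_inf_lbound; exists n.
(* The infimum is an extended real; if it is [+oo], any positive constant serves. *)
have [c c0 ce] : exists2 c : R, 0 < c & (c%:E <= e)%E.
  move: e0 {lb}; case: e => [r r0|_|//]; first by exists r.
  by exists 1; rewrite ?leey.
exists c => //; exists k => // n /= kn.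
by rewrite -lee_fin (le_trans ce)// lb.
Qed.

Lemma limn_einf_ge_near (R : realType) (u : nat -> R) (c : R) :
  (\forall n \near \oo, c <= u n) -> (c%:E <= limn_einf (fun n => (u n)%:E))%E.
Proof.
move=> [k _ ku]; rewrite limn_einfE.
apply: le_trans (ereal_sup_ubound (_ : range _ (einfs _ k))); last by exists k.
by apply: le_ereal_inf_tmp => _ [n /= kn <-]; rewrite lee_fin ku.
Qed.

Lemma near_ln_ge (R : realType) (A : R) : \forall n \near \oo, A <= ln (n%:R : R).
Proof.
near=> n.
have An : expR A <= n%:R by near: n; exact: nbhs_infty_ger.
by rewrite -[leLHS]expRK ler_ln ?posrE ?expR_gt0// (lt_le_trans (expR_gt0 A)).
Unshelve. all: end_near. Qed.

Lemma near_subsample_ge (R : realType) (u v : nat -> R) (d : nat -> nat) j :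
  (forall n, 0 <= u n) -> (forall n, 0 <= v n) ->
  liminfOmega (fun n => u n * v n) (fun n => ln n%:R ^+ j / (d n)%:R) ->
  exists2 c : R, 0 < c & \forall n \near \oo,
    (0 < d n)%N /\ c * ln n%:R ^+ j <= u n * v n * (d n)%:R.
Proof.
move=> u0 v0 /liminfOmega_near[c c0 H]; exists c => //; near=> n.
have : c <= `|u n * v n| / (ln n%:R ^+ j / (d n)%:R) by near: n.
have L0 : 0 < ln n%:R :> R.
  by apply: (@lt_le_trans _ _ 1) => //; near: n; exact: near_ln_ge.
(* For [d n = 0] the quotient is 0 by convention, against [c > 0]; this is how positivity of [d n]
   is obtained. *)
have [->|d0] := posnP (d n).
  by rewrite invr0 mulr0 invr0 mulr0 => /(lt_le_trans c0); rewrite ltxx.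
by rewrite ger0_norm ?mulr_ge0// invf_div mulrA ler_pdivlMr ?exprn_gt0//.
Unshelve. all: end_near. Qed.

Theorem corollary1 (R : realType)
  (m : nat -> nat)
  (p q su1 su2 sa1 sa2 : nat -> R)
  (hp : forall n, 0 <= p n <= 1)
  (hq : forall n, 0 <= q n <= 1)
  (hsu1 : forall n, 0 <= su1 n <= 1)
  (hsu2 : forall n, 0 <= su2 n <= 1)
  (hsa1 : forall n, 0 <= sa1 n <= 1)
  (hsa2 : forall n, 0 <= sa2 n <= 1)
  (pp qq : nat -> bool -> bool -> R)
  (hpp : forall n a b, pp n a b = subsample (p n) (su1 n) (su2 n) a b)
  (hqq : forall n a b, qq n a b = subsample (q n) (sa1 n) (sa2 n) a b)
  (hcorr : forall n, edges_positively_correlated n (m n) (pp n) (qq n))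
  (hp1 : limTheta (fun n => 1 - p n) (fun=> 1))
  (hq1 : limTheta (fun n => 1 - q n) (fun=> 1))
  (hsu : liminfOmega (fun n => su1 n * su2 n)
                     (fun n => ln n%:R ^+ 4 / n%:R))
  (hsa : liminfOmega (fun n => sa1 n * sa2 n)
                     (fun n => ln n%:R ^+ 3 / (m n)%:R)) :
  ((fun n => n%:R * pp n true true + (m n)%:R * qq n true true - ln n%:R)
     @ \oo --> +oo ->
   forall piMAP : forall n, estimator n (m n),
     (forall n, is_MAP (pp n) (qq n) (piMAP n)) ->
     (fun n => error_prob (pp n) (qq n) (piMAP n)) @ \oo --> (0 : R))
  /\
  ((fun n => n%:R * pp n true true + (m n)%:R * qq n true true - ln n%:R)
     @ \oo --> -oo ->
   forall est : forall n, estimator n (m n),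
     (0 < limn_einf (fun n => (error_prob (pp n) (qq n) (est n))%:E))%E).
Proof.
have ppE n : pp n = subsample (p n) (su1 n) (su2 n).
  by apply/funext => a; apply/funext => b.
have qqE n : qq n = subsample (q n) (sa1 n) (sa2 n).
  by apply/funext => a; apply/funext => b.
have pos (s : nat -> R) : (forall n, 0 <= s n <= 1) -> forall n, 0 <= s n.
  by move=> s01 n; case/andP: (s01 n).
have [cu cu0 su_large] := near_subsample_ge (pos _ hsu1) (pos _ hsu2) hsu.
have [ca ca0 sa_large] := near_subsample_ge (pos _ hsa1) (pos _ hsa2) hsa.
split => [excess piMAP MAP|deficit est].
  have [cp cp0 p_le] := liminfOmega_near hp1.2.
  have [cq cq0 q_le] := liminfOmega_near hq1.2.
  have c10 : 0 < Num.min cp cq by rewrite lt_min cp0.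
  apply/cvgr0Pnorm_le => e e0.
  (* By [expR (- r) <= r^-1], each of the three error terms is at most [e / 3] once [n] and [K] are
     at least [6 / e]. *)
  pose K := Num.max 1 (6 / e).
  have K1 : 1 <= K by rewrite le_max lexx.
  have [L0 [K0 bound]] := MAP_error_le_eventually cu0 ca0 c10 K1.
  near=> n.
  have err_ge0 : 0 <= error_prob (pp n) (qq n) (piMAP n).
    rewrite ppE qqE; apply: sumr_ge0 => w _; apply: law_ge0.
      exact: subsample_ge0.
    exact: subsample_ge0.
  rewrite ger0_norm//.
  have onem x c : 0 <= x <= 1 -> c <= `|1 - x| / 1 -> Num.min cp cq <= c ->
      Num.min cp cq <= 1 - x.
    move=> /andP[_ x1]; rewrite divr1 ger0_norm ?subr_ge0// => cx mc.
    exact: le_trans mc cx.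
  have n6 : (6 <= n)%N by near: n; exact: nbhs_infty_ge.
  have small r : 6 / e <= r -> 2 * expR (- r) <= e / 3.
    move=> er; have r0 : 0 < 6 / e by rewrite divr_gt0.
    have r_gt0 : 0 < r by exact: lt_le_trans er.
    have : expR (- r) <= r^-1.
      rewrite expRN lef_pV2 ?posrE ?expR_gt0// (le_trans _ (expR_ge1Dx _))//.
      by rewrite lerDr.
    have : r^-1 <= (6 / e)^-1 by rewrite lef_pV2 ?posrE.
    rewrite invf_div; lra.
  have ne : 6 / e <= n%:R by near: n; exact: nbhs_infty_ger.
  apply: (@le_trans _ _ (2 / n%:R + expR (- n%:R) + 2 * expR (- K))); last first.
    have h1 := small _ ne; have h2 : 2 * expR (- K) <= e / 3.
      by apply: small; rewrite le_max lexx orbT.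
    have h3 : 2 / n%:R <= e / 3.
      have : (n%:R)^-1 <= (6 / e)^-1 by rewrite lef_pV2 ?posrE ?divr_gt0 ?ltr0n// (leq_trans _ n6).
      rewrite invf_div; lra.
    have := expR_ge0 (- n%:R : R); lra.
  rewrite ppE qqE; apply: bound => //.
  - by near: n; exact: near_ln_ge.
  - apply: (onem _ cp) => //; last by rewrite ge_min lexx.
    by near: n.
  - apply: (onem _ cq) => //; last by rewrite ge_min lexx orbT.
    by near: n.
  - by have [] : (0 < n)%N /\ cu * ln n%:R ^+ 4 <= su1 n * su2 n * n%:R by near: n.
  - by have [] : (0 < m n)%N /\ ca * ln n%:R ^+ 3 <= sa1 n * sa2 n * (m n)%:R by near: n.
  - by rewrite -ppE -qqE; near: n; move/cvgryPge: excess; exact.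
  - by rewrite -ppE -qqE; exact: MAP.
apply: (@lt_le_trans _ _ (4^-1)%:E); first by rewrite lte_fin.
apply: limn_einf_ge_near; have [L0 bound] := error_ge_quarter_eventually ca0.
near=> n; have [m0 t_large] : (0 < m n)%N /\
    ca * ln n%:R ^+ 3 <= sa1 n * sa2 n * (m n)%:R by near: n.
rewrite ppE qqE; apply: bound => //.
- by near: n; exact: nbhs_infty_ge.
- by near: n; exact: near_ln_ge.
- by rewrite -ppE -qqE; near: n; move/cvgrNyPle: deficit; exact.
Unshelve. all: end_near. Qed.
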